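(* For all $u\in C^1[0,\varrho_\Omega)$, the following equality holds: $$\mathbf{T}_{\frac1f}u(r)=\frac{1}{f(r)}\left(\int_0^r\frac{f(s)\,\mathbf{T}_f[su'(s)]}{s}\,ds+u(0)\right),\qquad r\in[0,\varrho_\Omega),$$ where $\mathbf{T}_f[su'(s)]$ denotes the value at $s$ of $\mathbf{T}_f$ applied to the function $s\mapsto su'(s)$.
   Context: Setting. $\varrho_\Omega>0$ is the supremum of $|z|$ over a bounded domain $\Omega\subset\mathbb{C}$ star-shaped with respect to $0$ (only the number $\varrho_\Omega$ matters here). The function $q_f\in C^1[0,\varrho_\Omega]$ is complex-valued, and $f\in C^2[0,\varrho_\Omega]$ is complex-valued, nowhere zero on $[0,\varrho_\Omega]$, satisfies $f''(r)+\frac1rf'(r)-q_f(r)f(r)=0$ on $(0,\varrho_\Omega)$, with $z\mapsto f(|z|)$ in $C^2(\overline\Omega)$, and is normalized by $f(0)=1$ and $\lim_{r\to0^+}rf'(r)=0$. Put $q_{\frac1f}=2\left(\frac{f'}{f}\right)^2-q_f$, the potential associated in the same way to $\frac1f$. For $g\in\{f,\frac1f\}$ let $G^g\in C^2([0,\varrho_\Omega]\times[0,1])$ be the kernel (known to exist) satisfying $$r\left(G^g_{rr}(r,t)-q_g(r)G^g(r,t)\right)-G^g_r(r,t)+2(1-t)G^g_{rt}(r,t)=0,$$ $$G^g(r,0)=\int_0^r\tau q_g(\tau)\,d\tau,\qquad G^g(0,t)=0.$$ On functions $u$ of the radial variable, $\mathbf{T}_gu(r)=u(r)+\int_0^1\sigma\,G^g(r,1-\sigma^2)\,u(\sigma^2r)\,d\sigma$.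 Functions $u$ are complex-valued. *)

(* Defs.v *)
From Stdlib Require Import Reals.
From Coquelicot Require Import Coquelicot.

Open Scope R_scope.
Open Scope C_scope.

Definition Icc (a b x : R) : Prop := (a <= x <= b)%R.
Definition Ico (a b x : R) : Prop := (a <= x < b)%R.

(* Derivative relative to D: two-sided in the interior of an interval D, and
   one-sided at an endpoint belonging to D. *)
Definition is_derive_on (D : R -> Prop) (h : R -> C) (x : R) (l : C) : Prop :=
  @filterdiff R_AbsRing R_NormedModule C_R_NormedModule h
    (within D (locally x)) (fun y : R => RtoC y * l).

(* h is of class C^1 on D with derivative dh. Functions on D are represented by
   total functions whose values outside D are irrelevant. *)
Definition is_C1_on (D : R -> Prop) (h dh : R -> C) : Prop :=
  (forall x, D x -> is_derive_on D h x (dh x)) /\ continuous_on D dh.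

Definition rect (rho : R) (p : R * R) : Prop :=
  Icc 0 rho (fst p) /\ Icc 0 1 (snd p).

(* H is of class C^1 on [0, rho] x [0, 1], up to the boundary, with partial
   derivatives Hr and Ht. *)
Definition is_C1_rect (rho : R) (H Hr Ht : R -> R -> C) : Prop :=
  (forall r t, Icc 0 rho r -> Icc 0 1 t ->
     is_derive_on (Icc 0 rho) (fun x => H x t) r (Hr r t) /\
     is_derive_on (Icc 0 1) (fun y => H r y) t (Ht r t)) /\
  continuous_on (rect rho) (fun p => Hr (fst p) (snd p)) /\
  continuous_on (rect rho) (fun p => Ht (fst p) (snd p)).

(* Existence of the kernel's derivatives is part of the predicate; the
   differential equation is imposed up to the boundary, which by continuity is
   the same as imposing it in the interior. *)
Definition is_kernel (rho : R) (q : R -> C) (G : R -> R -> C) : Prop :=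
  exists Gr Gt Grr Grt Gtr Gtt : R -> R -> C,
    is_C1_rect rho G Gr Gt /\ is_C1_rect rho Gr Grr Grt /\
    is_C1_rect rho Gt Gtr Gtt /\
    (forall r t, Icc 0 rho r -> Icc 0 1 t ->
       RtoC r * (Grr r t - q r * G r t) - Gr r t
       + 2 * (1 - RtoC t) * Grt r t = 0) /\
    (forall r, Icc 0 rho r ->
       G r 0%R = @RInt C_R_CompleteNormedModule
                   (fun tau : R => RtoC tau * q tau) 0 r) /\
    (forall t, Icc 0 1 t -> G 0%R t = 0).

Definition T (G : R -> R -> C) (u : R -> C) (r : R) : C :=
  u r + @RInt C_R_CompleteNormedModule
          (fun sigma : R => RtoC sigma * G r (1 - sigma ^ 2)%R
                            * u (sigma ^ 2 * r)%R) 0 1.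

(* If f'' + f'/r - q f = 0 and f' = df, then g = 1/f satisfies
   g'' + g'/r - (q_inv q f df) g = 0. *)
Definition q_inv (q f df : R -> C) (r : R) : C :=
  2 * (df r / f r) ^ 2 - q r.

(* Bounded domain star-shaped with respect to 0, with rho = sup |z|.
   Connectedness follows from star-shapedness, and boundedness from the
   existence of the supremum. *)
Definition star_domain (Omega : C -> Prop) (rho : R) : Prop :=
  open Omega /\ (exists z, Omega z) /\
  (forall z (t : R), Omega z -> Icc 0 1 t -> Omega (RtoC t * z)) /\
  is_lub (fun x => exists z, Omega z /\ x = Cmod z) rho.

Definition closure (Omega : C -> Prop) (z : C) : Prop :=
  forall eps : R, (0 < eps)%R -> exists w, Omega w /\ (Cmod (w - z) < eps)%R.

(* h has partial derivatives hx and hy in Omega, all three being continuous up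
   to the boundary; z = (x, y) is identified with x + i y. *)
Definition is_C1_closure (Omega : C -> Prop) (h hx hy : C -> C) : Prop :=
  (forall z, Omega z ->
     @is_derive R_AbsRing C_R_NormedModule
       (fun x : R => h (x, Im z)) (Re z) (hx z) /\
     @is_derive R_AbsRing C_R_NormedModule
       (fun y : R => h (Re z, y)) (Im z) (hy z)) /\
  continuous_on (closure Omega) h /\
  continuous_on (closure Omega) hx /\
  continuous_on (closure Omega) hy.

Definition C2_closure (Omega : C -> Prop) (h : C -> C) : Prop :=
  exists hx hy hxx hxy hyx hyy : C -> C,
    is_C1_closure Omega h hx hy /\ is_C1_closure Omega hx hxx hxy /\
    is_C1_closure Omega hy hyx hyy.

(* Main.v *)
Require Import Defs.
From Stdlib Require Import Reals Lra ClassicalEpsilon.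
From Coquelicot Require Import Coquelicot.

Open Scope R_scope.
Open Scope C_scope.

(** Write a = f'/f, G for the kernel of f, H for the kernel of 1/f, M = H - G and
    S = H + G. With w = q - a^2, the potentials of G and H are a^2 + w and a^2 - w,
    and the equation of f reads (r a)' = r w.

    The claim is an identity between functions of r that agree at r = 0, so it
    suffices to compare the derivatives of f * T_(1/f) u and of the integral. After
    differentiating under the integral sign, the difference of the two integrands
    in sigma is, up to a factor, the derivative in sigma of
    sigma^2 M(r, 1 - sigma^2) u(sigma^2 r), provided that
    r H_r + r a H = M - (1 - t) M_t                                           (R)
    holds with t = 1 - sigma^2. The boundary term at sigma = 1 cancels because
    M(r, 0) = - 2 r a(r).

    The relation (R) between the kernels says P + Q = 0 for
    P = r S_r + r a M   and   Q = r M_r + r a S + 2 ((1 - t) M_t - M),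
    and in fact P = Q = 0. The two kernel equations turn into the first order system
    Q_r = a P,    r P_r + 2 (1 - t) P_t - 2 P = r a Q,
    with P(r, 0) = 0 and Q(0, t) = 0. The second equation is an ordinary differential
    equation for P / r^2 along the characteristics (1 - t) r^2 = c^2, which start on
    the axis t = 0. A Gronwall argument then forces P = Q = 0 (lemma
    goursat_system_uniqueness). It starts from the bound |P| <= m r, plain from the
    factor r in P, which makes up for the singularity of the system at r = 0.

    Functions given on an interval or a rectangle are precomposed with the projection
    onto it (clamp). They become continuous everywhere and keep their derivatives
    in the interior, so that no one-sided derivative enters the argument. *)

(** * Calculus of complex-valued functions *)

(** Derivative of a complex-valued function of a real variable. *)
Notation is_derive_C h x l := (@is_derive R_AbsRing C_R_NormedModule h x l).

Lemma is_derive_C_Re_Im (h : R -> C) (x : R) (l : C) :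
  is_derive_C h x l <->
  is_derive (fun y => Re (h y)) x (Re l) /\ is_derive (fun y => Im (h y)) x (Im l).
Proof.
  split.
  - intros H; split.
    + apply (filterdiff_comp' (K := R_AbsRing) (U := R_NormedModule)
        (V := C_R_NormedModule) (W := R_NormedModule) h fst x (fun y => scal y l) fst H).
      apply filterdiff_linear, (is_linear_fst (U := R_NormedModule) (V := R_NormedModule)).
    + apply (filterdiff_comp' (K := R_AbsRing) (U := R_NormedModule)
        (V := C_R_NormedModule) (W := R_NormedModule) h snd x (fun y => scal y l) snd H).
      apply filterdiff_linear, (is_linear_snd (U := R_NormedModule) (V := R_NormedModule)).
  - intros [H1 H2].
    apply (is_derive_ext (V := C_R_NormedModule)
      (fun y => plus (scal (Re (h y)) (1, 0)%R : C_R_NormedModule) (scal (Im (h y)) (0, 1)%R))).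
    + intros y. destruct (h y) as [p q].
      apply injective_projections; simpl.
      * change (p * 1 + q * 0 = p)%R; ring.
      * change (p * 0 + q * 1 = q)%R; ring.
    + replace l with (plus (scal (Re l) (1, 0)%R : C_R_NormedModule) (scal (Im l) (0, 1)%R)).
      * apply @is_derive_plus; apply @is_derive_scal_l; assumption.
      * destruct l as [p q].
        apply injective_projections; simpl.
        -- change (p * 1 + q * 0 = p)%R; ring.
        -- change (p * 0 + q * 1 = q)%R; ring.
Qed.

Lemma continuous_C_Re_Im {T : UniformSpace} (h : T -> C) (x : T) :
  continuous h x <->
  continuous (fun y => Re (h y)) x /\ continuous (fun y => Im (h y)) x.
Proof.
  split.
  - intros H; split.
    + apply (continuous_comp h (fun z : C => fst z)); [exact H | apply continuous_fst].
    + apply (continuous_comp h (fun z : C => snd z)); [exact H | apply continuous_snd].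
  - intros [H1 H2] P [eps HP].
    change (locally x (fun y => P (h y))).
    apply (filter_imp (fun y => ball (Re (h x)) eps (Re (h y)) /\
                                ball (Im (h x)) eps (Im (h y)))).
    + intros y [A B]. apply HP. split; assumption.
    + apply filter_and; [apply (H1 (ball (Re (h x)) eps)) | apply (H2 (ball (Im (h x)) eps))];
        apply locally_ball.
Qed.

Lemma continuous_Cmult {T : UniformSpace} (f g : T -> C) x :
  continuous f x -> continuous g x -> continuous (fun y => f y * g y) x.
Proof.
  intros Hf Hg. apply continuous_C_Re_Im in Hf, Hg. destruct Hf as [a b], Hg as [c d].
  apply continuous_C_Re_Im; split; unfold Re, Im, Cmult; simpl.
  - apply (continuous_minus (V := R_NormedModule)); apply (continuous_mult (K := R_AbsRing)); assumption.
  - apply (continuous_plus (V := R_NormedModule)); apply (continuous_mult (K := R_AbsRing)); assumption.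
Qed.

Lemma continuous_Cplus {T : UniformSpace} (f g : T -> C) x :
  continuous f x -> continuous g x -> continuous (fun y => f y + g y) x.
Proof. exact (continuous_plus (V := C_R_NormedModule) f g x). Qed.

Lemma continuous_Cminus {T : UniformSpace} (f g : T -> C) x :
  continuous f x -> continuous g x -> continuous (fun y => f y - g y) x.
Proof. exact (continuous_minus (V := C_R_NormedModule) f g x). Qed.

Lemma continuous_RtoC {T : UniformSpace} (f : T -> R) x :
  continuous f x -> continuous (fun y => RtoC (f y)) x.
Proof.
  intros H. apply continuous_C_Re_Im; split; simpl; [exact H | apply continuous_const].
Qed.

Lemma Csqnorm_neq0 (z : C) : z <> 0 -> (Re z ^ 2 + Im z ^ 2 <> 0)%R.
Proof.
  intros H E. apply H. destruct z as [p q]; simpl in E.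
  apply injective_projections; simpl; nra.
Qed.

Lemma continuous_Cinv {T : UniformSpace} (f : T -> C) x :
  continuous f x -> f x <> 0 -> continuous (fun y => / f y) x.
Proof.
  intros Hf H0. apply continuous_C_Re_Im in Hf. destruct Hf as [a b].
  apply Csqnorm_neq0 in H0.
  assert (N : continuous (fun y => / (Re (f y) ^ 2 + Im (f y) ^ 2))%R x).
  { apply (continuous_comp (fun y => Re (f y) ^ 2 + Im (f y) ^ 2)%R Rinv); [ | apply continuous_Rinv, H0].
    apply (continuous_plus (V := R_NormedModule)); simpl; unfold Re, Im in *;
    (apply (continuous_mult (K := R_AbsRing));
      [ | apply (continuous_mult (K := R_AbsRing)); [ | apply continuous_const]]); assumption. }
  apply continuous_C_Re_Im; split; unfold Re, Im, Cinv; simpl.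
  - apply (continuous_mult (K := R_AbsRing)); assumption.
  - apply (continuous_mult (K := R_AbsRing)); [ | exact N].
    apply (continuous_opp (V := R_NormedModule)); assumption.
Qed.

Lemma is_derive_C_eq (h : R -> C) (x : R) (l l' : C) : is_derive_C h x l -> l = l' -> is_derive_C h x l'.
Proof. intros H <-; exact H. Qed.

Lemma is_derive_C_continuous (h : R -> C) x l : is_derive_C h x l -> continuous h x.
Proof. intros H. apply (ex_derive_continuous (V := C_R_NormedModule)). exists l; exact H. Qed.

Lemma is_derive_Cmult (f g : R -> C) x df dg :
  is_derive_C f x df -> is_derive_C g x dg -> is_derive_C (fun y => f y * g y) x (df * g x + f x * dg).
Proof.
  intros Hf Hg. apply is_derive_C_Re_Im in Hf, Hg. destruct Hf as [a b], Hg as [c d].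
  apply is_derive_C_Re_Im; split; unfold Re, Im, Cmult, Cplus in *; simpl.
  - evar_last.
    { apply @is_derive_minus; apply (is_derive_mult (K := R_AbsRing)); try eassumption; exact Rmult_comm. }
    unfold minus, plus, opp, mult; simpl; ring.
  - evar_last.
    { apply @is_derive_plus; apply (is_derive_mult (K := R_AbsRing)); try eassumption; exact Rmult_comm. }
    unfold minus, plus, opp, mult; simpl; ring.
Qed.

Lemma is_derive_Cplus (f g : R -> C) x df dg :
  is_derive_C f x df -> is_derive_C g x dg -> is_derive_C (fun y => f y + g y) x (df + dg).
Proof. exact (is_derive_plus (V := C_R_NormedModule) f g x df dg). Qed.

Lemma is_derive_Cminus (f g : R -> C) x df dg :
  is_derive_C f x df -> is_derive_C g x dg -> is_derive_C (fun y => f y - g y) x (df - dg).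
Proof. exact (is_derive_minus (V := C_R_NormedModule) f g x df dg). Qed.

Lemma is_derive_Cconst (c : C) x : is_derive_C (fun _ => c) x (RtoC 0).
Proof. exact (is_derive_const (V := C_R_NormedModule) c x). Qed.

Lemma is_derive_RtoC (f : R -> R) x l :
  is_derive f x l -> is_derive_C (fun y => RtoC (f y)) x (RtoC l).
Proof.
  intros H. apply is_derive_C_Re_Im; split; simpl; [exact H | apply @is_derive_const].
Qed.

Lemma is_derive_Cinv (f : R -> C) x l :
  is_derive_C f x l -> f x <> 0 -> is_derive_C (fun y => / f y) x (- l * (/ f x * / f x)).
Proof.
  intros Hf H0. pose proof (Csqnorm_neq0 _ H0) as N.
  apply is_derive_C_Re_Im in Hf. destruct Hf as [a b].
  assert (D : is_derive (fun y => fst (f y) * (fst (f y) * 1) + snd (f y) * (snd (f y) * 1))%R x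
     (2 * (Re (f x) * Re l + Im (f x) * Im l))%R).
  { evar_last.
    - apply @is_derive_plus;
      (apply (is_derive_mult (K := R_AbsRing)); [eassumption | | exact Rmult_comm];
       apply (is_derive_mult (K := R_AbsRing)); [eassumption | | exact Rmult_comm];
       apply (is_derive_const (K := R_AbsRing) (V:=R_NormedModule))).
    - unfold plus, mult, zero, Re, Im; simpl; ring. }
  apply is_derive_C_Re_Im; split; unfold Re, Im, Cinv, Cmult, Copp in *; simpl in *.
  - evar_last.
    + apply (is_derive_div (fun y => fst (f y)) _ x _ _ a D N).
    + simpl. field. intros E; apply N; rewrite <- E; ring.
  - evar_last.
    + apply (is_derive_div (fun y => (- snd (f y))%R) _ x _ _
        (is_derive_opp (V := R_NormedModule) _ _ _ b) D N).
    + unfold opp; simpl. field. intros E; apply N; rewrite <- E; ring.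
Qed.

Lemma is_derive_C_id (x : R) : is_derive_C (fun y => RtoC y) x (RtoC 1).
Proof. apply (is_derive_RtoC (fun y => y)), (is_derive_id (K := R_AbsRing)). Qed.

(** Continuity and derivatives of polynomial expressions, read off the syntax;
    [leaf] deals with the atoms. *)
Ltac continuous_C leaf :=
  lazymatch goal with
  | |- continuous (fun y => Cplus (@?f y) (@?g y)) _ =>
      apply (continuous_Cplus f g); continuous_C leaf
  | |- continuous (fun y => Cminus (@?f y) (@?g y)) _ =>
      apply (continuous_Cminus f g); continuous_C leaf
  | |- continuous (fun y => Cmult (@?f y) (@?g y)) _ =>
      apply (continuous_Cmult f g); continuous_C leaf
  | |- continuous (fun y => RtoC y) _ => apply continuous_RtoC, continuous_id
  | |- continuous (fun _ => ?c) _ => apply continuous_const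
  | _ => leaf
  end.

Ltac derive_C leaf :=
  lazymatch goal with
  | |- is_derive (fun y => Cplus (@?f y) (@?g y)) _ _ =>
      apply (is_derive_Cplus f g); derive_C leaf
  | |- is_derive (fun y => Cminus (@?f y) (@?g y)) _ _ =>
      apply (is_derive_Cminus f g); derive_C leaf
  | |- is_derive (fun y => Cmult (@?f y) (@?g y)) _ _ =>
      apply (is_derive_Cmult f g); derive_C leaf
  | |- is_derive (fun y => RtoC y) _ _ => apply is_derive_C_id
  | |- is_derive (fun _ => ?c) _ _ => apply is_derive_Cconst
  | _ => leaf
  end.

Lemma is_derive_C_unique (h : R -> C) (x : R) (l l' : C) : is_derive_C h x l -> is_derive_C h x l' -> l = l'.
Proof.
  intros H H'. apply is_derive_C_Re_Im in H, H'. destruct H as [h1 h2], H' as [h3 h4].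
  apply injective_projections.
  - apply (eq_trans (eq_sym (is_derive_unique _ _ _ h1)) (is_derive_unique _ _ _ h3)).
  - apply (eq_trans (eq_sym (is_derive_unique _ _ _ h2)) (is_derive_unique _ _ _ h4)).
Qed.

Lemma RtoC_neq0 (r : R) : r <> 0%R -> RtoC r <> 0.
Proof. intros H E. apply H. apply (f_equal fst) in E. exact E. Qed.

(** Presents the type of an equation as [C] itself, as the algebraic tactics
    require, instead of the carrier of a normed module. *)
Ltac eq_C := match goal with |- ?a = ?b => change (@eq C a b) end.

(** * Clamping to an interval *)

(** The nearest point projection of the line onto [a, b], for a <= b. *)
Definition clamp (a b x : R) : R := Rmax a (Rmin b x).

Lemma clamp_in a b x : (a <= b)%R -> (a <= clamp a b x <= b)%R.
Proof.
  intros H. unfold clamp, Rmax, Rmin.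
  destruct (Rle_dec b x); destruct (Rle_dec a _); lra.
Qed.

Lemma clamp_id a b x : (a <= x <= b)%R -> clamp a b x = x.
Proof.
  intros H. unfold clamp, Rmax, Rmin.
  destruct (Rle_dec b x); destruct (Rle_dec a _); lra.
Qed.

Lemma clamp_lipschitz a b x y : (Rabs (clamp a b x - clamp a b y) <= Rabs (x - y))%R.
Proof.
  unfold clamp, Rmax, Rmin.
  destruct (Rle_dec b x); destruct (Rle_dec a _); destruct (Rle_dec b y);
  destruct (Rle_dec a _); unfold Rabs; repeat destruct Rcase_abs; lra.
Qed.

Lemma continuous_clamp a b x : continuous (clamp a b) x.
Proof.
  apply filterlim_locally. intros eps. exists eps. intros y Hy.
  apply (Rle_lt_trans _ (Rabs (y - x))); [apply clamp_lipschitz | exact Hy].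
Qed.

Lemma locally_open_interval (a b x : R) :
  (a < x < b)%R -> locally x (fun y => (a < y < b)%R).
Proof.
  intros [H1 H2]. apply filter_and; [apply (open_gt a x H1) | apply (open_lt b x H2)].
Qed.

Lemma is_filter_lim_within (D : R -> Prop) x :
  is_filter_lim (T := R_UniformSpace) (within D (locally x)) x.
Proof. intros P HP. unfold within. revert HP. apply filter_imp. auto. Qed.

Lemma is_derive_on_continuous D h x l :
  is_derive_on D h x l -> filterlim h (within D (locally x)) (locally (h x)).
Proof.
  intros H. apply (filterdiff_continuous_aux (K := R_AbsRing) (U := R_NormedModule)
    (V := C_R_NormedModule) (F := within D (locally x))).
  - exists (fun y : R => RtoC y * l). exact H.
  - apply is_filter_lim_within.
Qed.

Lemma scal_C (y : R) (l : C) : (scal y l : C_R_NormedModule) = RtoC y * l.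
Proof.
  destruct l as [p q]. apply injective_projections; simpl; unfold scal; simpl; unfold mult; simpl; ring.
Qed.

Lemma is_derive_on_interior (D : R -> Prop) h x l :
  locally x D -> is_derive_on D h x l -> is_derive_C h x l.
Proof.
  intros HD [_ H]. split.
  - apply is_linear_scal_l.
  - intros y Hy eps.
    assert (y = x) as -> by (symmetry; apply (is_filter_lim_locally_unique (K := R_AbsRing) (V := R_NormedModule)), Hy).
    specialize (H x (is_filter_lim_within D x) eps). unfold within in H.
    generalize (filter_and _ _ HD H). apply filter_imp.
    intros z [Hz Hn]. specialize (Hn Hz). rewrite scal_C. exact Hn.
Qed.

Lemma continuous_on_clamp a b (h : R -> C) x :
  (a <= b)%R -> continuous_on (Icc a b) h -> continuous (fun y => h (clamp a b y)) x.
Proof.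
  intros Hab H. unfold continuous.
  apply (filterlim_comp _ _ _ (clamp a b) h _ (within (Icc a b) (locally (clamp a b x)))).
  - intros P HP. unfold within in HP.
    apply (continuous_clamp a b x) in HP. unfold filtermap in *.
    revert HP; apply filter_imp. intros y Hy. apply Hy, clamp_in, Hab.
  - apply H, clamp_in, Hab.
Qed.

Lemma continuous_on_clamp_rect rho (F : R -> R -> C) (p : R * R) :
  (0 <= rho)%R -> continuous_on (rect rho) (fun p => F (fst p) (snd p)) ->
  continuous (fun p : R * R => F (clamp 0 rho (fst p)) (clamp 0 1 (snd p))) p.
Proof.
  intros Hab H. unfold continuous.
  set (g := fun p : R * R => (clamp 0 rho (fst p), clamp 0 1 (snd p))).
  assert (Hg : forall p, rect rho (g p)).
  { intros z; split; apply clamp_in; lra. }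
  apply (filterlim_comp _ _ _ g (fun p => F (fst p) (snd p)) _ (within (rect rho) (locally (g p)))).
  - assert (C : continuous (U := prod_UniformSpace R_UniformSpace R_UniformSpace) g p).
    { apply filterlim_locally. intros eps. exists eps. intros z [H1 H2]. split; simpl.
      - apply (Rle_lt_trans _ (Rabs (fst z - fst p))); [apply clamp_lipschitz | exact H1].
      - apply (Rle_lt_trans _ (Rabs (snd z - snd p))); [apply clamp_lipschitz | exact H2]. }
    intros P HP. unfold within in HP. apply C in HP. unfold filtermap in *.
    revert HP; apply filter_imp. intros y Hy. apply Hy, Hg.
  - apply (H (g p)), Hg.
Qed.

Lemma continuous_on_of_derive (D : R -> Prop) (h dh : R -> C) :
  (forall x, D x -> is_derive_on D h x (dh x)) -> continuous_on D h.
Proof. intros H x Hx. apply (is_derive_on_continuous D h x (dh x)), H, Hx. Qed.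

Lemma is_derive_C_clamp (a b : R) (h : R -> C) x l :
  (a < x < b)%R -> is_derive_on (Icc a b) h x l -> is_derive_C (fun y => h (clamp a b y)) x l.
Proof.
  intros Hx Hd.
  apply (is_derive_ext_loc (V := C_R_NormedModule) h).
  - apply filter_imp with (2 := locally_open_interval _ _ _ Hx). intros y Hy.
    rewrite clamp_id; [reflexivity | lra].
  - apply (is_derive_on_interior (Icc a b)); [ | exact Hd].
    apply filter_imp with (2 := locally_open_interval _ _ _ Hx). intros y Hy. unfold Icc; lra.
Qed.

(** * Mean value inequality and integrals *)

(** Mean value inequality. Differentiability of [h] is needed in the interior only. *)
Lemma Cmod_increment_le (h dh : R -> C) (phi dphi : R -> R) (a b : R) :
  (a <= b)%R ->
  (forall x, (a < x < b)%R -> is_derive_C h x (dh x)) ->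
  (forall x, (a <= x <= b)%R -> continuous h x) ->
  (forall x, (a <= x <= b)%R -> is_derive phi x (dphi x)) ->
  (forall x, (a < x < b)%R -> (Cmod (dh x) <= dphi x)%R) ->
  (Cmod (h b - h a) <= phi b - phi a)%R.
Proof.
  intros Hab Hd Hc Hp Hle.
  destruct (Rle_lt_or_eq_dec a b Hab) as [Hlt | <-].
  2: { replace (h a - h a) with (RtoC 0) by ring. rewrite Cmod_0. lra. }
  set (z := h b - h a).
  assert (Hpc : forall x, (a <= x <= b)%R -> continuous phi x).
  { intros x Hx. apply (ex_derive_continuous (V := R_NormedModule)). eexists; apply Hp, Hx. }
  assert (Hmono : (0 <= phi b - phi a)%R).
  { destruct (MVT_gen phi a b (fun x => Rmax 0 (dphi x))) as [c [Hcab E]].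
    - rewrite Rmin_left, Rmax_right by lra. intros x Hx.
      rewrite Rmax_right; [apply Hp; lra | ].
      apply Rle_trans with (Cmod (dh x)); [apply Cmod_ge_0 | apply Hle, Hx].
    - rewrite Rmin_left, Rmax_right by lra. intros x Hx.
      apply continuity_pt_filterlim, Hpc, Hx.
    - rewrite E. apply Rmult_le_pos; [apply Rmax_l | lra]. }
  destruct (Req_dec (Cmod z) 0) as [Hz | Hz]; [fold z; lra | ].
  assert (Hz0 : (0 < Cmod z)%R) by (pose proof (Cmod_ge_0 z); lra).
  (* The real mean value theorem is applied to the projection on the direction of z. *)
  set (g := fun x => (Re z * Re (h x) + Im z * Im (h x) - Cmod z * phi x)%R).
  destruct (MVT_gen g a b (fun x => Rmin 0 (Re z * Re (dh x) + Im z * Im (dh x) - Cmod z * dphi x))%R)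
    as [c [Hcab E]].
  - rewrite Rmin_left, Rmax_right by lra. intros x Hx.
    rewrite Rmin_right.
    + pose proof (proj1 (is_derive_C_Re_Im _ _ _) (Hd x Hx)) as [d1 d2].
      unfold g. evar_last.
      * apply @is_derive_minus; [apply @is_derive_plus | ];
        (apply is_derive_scal; first [exact d1 | exact d2 | apply Hp; lra]).
      * reflexivity.
    + specialize (Hle x Hx).
      assert (Re z * Re (dh x) + Im z * Im (dh x) <= Cmod z * Cmod (dh x))%R.
      { pose proof (re_le_Cmod (Cconj z * dh x)) as R1.
        rewrite Cmod_mult, Cmod_conj in R1.
        replace (Re z * Re (dh x) + Im z * Im (dh x))%R with (Re (Cconj z * dh x)).
        - apply Rle_trans with (2 := R1), Rle_abs.
        - unfold Re, Im, Cconj, Cmult; simpl; ring. }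
      nra.
  - rewrite Rmin_left, Rmax_right by lra. intros x Hx. apply continuity_pt_filterlim.
    pose proof (proj1 (continuous_C_Re_Im _ _) (Hc x Hx)) as [c1 c2].
    apply (continuous_minus (V := R_NormedModule)
      (fun x => Re z * Re (h x) + Im z * Im (h x))%R (fun x => Cmod z * phi x)%R).
    + apply (continuous_plus (V := R_NormedModule)
        (fun x => Re z * Re (h x))%R (fun x => Im z * Im (h x))%R).
      * apply (continuous_scal_r (V := R_NormedModule) (Re z) _ _ c1).
      * apply (continuous_scal_r (V := R_NormedModule) (Im z) _ _ c2).
    + apply (continuous_scal_r (V := R_NormedModule) (Cmod z) _ _ (Hpc x Hx)).
  - assert (E2 : (g b - g a = Cmod z * (Cmod z - (phi b - phi a)))%R).
    { unfold g. assert (Q : (Cmod z * Cmod z = Re z * Re z + Im z * Im z)%R).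
      { pose proof (Cmod2_alt z). lra. }
      replace (Re z * Re z)%R with (Re z * (Re (h b) - Re (h a)))%R in Q by (unfold z; unfold Re; simpl; ring).
      replace (Im z * Im z)%R with (Im z * (Im (h b) - Im (h a)))%R in Q by (unfold z; unfold Im; simpl; ring).
      lra. }
    fold z. assert (g b - g a <= 0)%R.
    { rewrite E. match goal with |- (Rmin 0 ?y * _ <= _)%R => pose proof (Rmin_l 0 y) end. nra. }
    nra.
Qed.

(** Integral of a complex-valued function of a real variable. *)
Notation RInt_C f a b := (@RInt C_R_CompleteNormedModule f a b).

Lemma RInt_C_Re_Im (h : R -> C) (a b : R) :
  (forall x, Rmin a b <= x <= Rmax a b -> continuous h x)%R ->
  @RInt C_R_CompleteNormedModule h a b =
  (RInt (fun x => Re (h x)) a b, RInt (fun x => Im (h x)) a b).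
Proof.
  intros H. apply is_RInt_unique.
  apply (is_RInt_fct_extend_pair (U := R_NormedModule) (V := R_NormedModule));
  apply (RInt_correct (V := R_CompleteNormedModule)), ex_RInt_continuous;
  intros z Hz; apply (continuous_C_Re_Im h z), H, Hz.
Qed.

Lemma is_derive_C_RInt (k : R -> C) (a x : R) :
  (forall x, continuous k x) -> is_derive_C (fun x => RInt_C k a x) x (k x).
Proof.
  intros Hk. apply (is_derive_RInt (V := C_R_NormedModule) k (fun x => RInt_C k a x) a x); [ | apply Hk].
  apply filter_forall. intros y.
  apply (RInt_correct (V := C_R_CompleteNormedModule)), ex_RInt_continuous.
  intros; apply Hk.
Qed.

(** Fundamental theorem of calculus, without derivative of [h] at the endpoints. *)
Lemma RInt_C_FTC (h k : R -> C) (a b : R) :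
  (a <= b)%R ->
  (forall x, (a < x < b)%R -> is_derive_C h x (k x)) ->
  (forall x, (a <= x <= b)%R -> continuous h x) ->
  (forall x, continuous k x) ->
  @RInt C_R_CompleteNormedModule k a b = h b - h a.
Proof.
  intros Hab Hd Hc Hk.
  set (K := (fun x => @RInt C_R_CompleteNormedModule k a x) : R -> C).
  assert (DK : forall x, is_derive_C K x (k x)) by (intros x; apply is_derive_C_RInt, Hk).
  assert (E : (Cmod ((h b - K b) - (h a - K a)) <= 0 - 0)%R).
  { apply (Cmod_increment_le (fun x => h x - K x) (fun x => k x - k x) (fun _ => 0%R) (fun _ => 0%R) a b Hab).
    - intros x Hx. apply is_derive_Cminus; [apply Hd, Hx | apply DK].
    - intros x Hx. apply continuous_Cminus; [apply Hc, Hx | ].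
      eapply is_derive_C_continuous, DK.
    - intros x _. apply (is_derive_const (K := R_AbsRing) (V := R_NormedModule)).
    - intros x _. replace (k x - k x) with (RtoC 0) by ring. rewrite Cmod_0. lra. }
  assert (K0 : K a = RtoC 0) by (unfold K; apply (RInt_point (V := C_R_CompleteNormedModule))).
  rewrite K0 in E. fold (K b).
  assert (h b - K b - (h a - 0) = 0).
  { apply Cmod_eq_0. pose proof (Cmod_ge_0 (h b - K b - (h a - 0))). lra. }
  change (@eq C (K b) (h b - h a)). clear - H. generalize dependent (K b). intros w H.
  replace w with (h b - h a - (h b - w - (h a - 0))) by ring. rewrite H. ring.
Qed.

Lemma RInt_C_linear (k1 k2 k3 : R -> C) (c1 c2 c3 : C) (a b : R) :
  (a <= b)%R ->
  (forall x, continuous k1 x) -> (forall x, continuous k2 x) -> (forall x, continuous k3 x) ->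
  RInt_C (fun x => c1 * k1 x + c2 * k2 x + c3 * k3 x) a b =
  c1 * RInt_C k1 a b + c2 * RInt_C k2 a b + c3 * RInt_C k3 a b.
Proof.
  intros Hab H1 H2 H3.
  assert (D : forall x, is_derive_C (fun x => c1 * RInt_C k1 a x + c2 * RInt_C k2 a x + c3 * RInt_C k3 a x) x
     (c1 * k1 x + c2 * k2 x + c3 * k3 x)).
  { intros x. eapply is_derive_C_eq.
    - derive_C ltac:(apply is_derive_C_RInt; assumption).
    - cbv beta. ring. }
  set (k := fun x => RInt_C k1 a x : C) in *. set (l := fun x => RInt_C k2 a x : C) in *.
  set (m := fun x => RInt_C k3 a x : C) in *.
  assert (Z : k a = 0 /\ l a = 0 /\ m a = 0).
  { repeat split; apply (RInt_point (V := C_R_CompleteNormedModule)). }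
  change (RInt_C (fun x => c1 * k1 x + c2 * k2 x + c3 * k3 x) a b = c1 * k b + c2 * l b + c3 * m b).
  destruct Z as (Z1 & Z2 & Z3).
  change (forall x, is_derive_C (fun x => c1 * k x + c2 * l x + c3 * m x) x
     (c1 * k1 x + c2 * k2 x + c3 * k3 x)) in D.
  clearbody k l m.
  rewrite (RInt_C_FTC _ _ a b Hab (fun x _ => D x)).
  - rewrite Z1, Z2, Z3. eq_C. ring.
  - intros x _. eapply is_derive_C_continuous, D.
  - intros x. continuous_C ltac:(auto).
Qed.

(** * Jointly continuous functions of two variables *)

(** Continuity as a function of the pair of variables. *)
Definition jointly_continuous (F : R -> R -> C) : Prop :=
  forall p : R * R, continuous (fun p : R * R => F (fst p) (snd p)) p.

Lemma jointly_continuous_slice F (x : R) y : jointly_continuous F -> continuous (F x) y.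
Proof.
  intros H. apply (continuous_comp_2 (fun _ : R => x) (fun v : R => v) F).
  - apply continuous_const.
  - apply continuous_id.
  - apply H.
Qed.

Lemma continuous_curve (F : R -> R -> C) (al be : R -> R) s :
  jointly_continuous F -> continuous al s -> continuous be s ->
  continuous (fun s => F (al s) (be s)) s.
Proof. intros H Ha Hb. apply (continuous_comp_2 al be F s Ha Hb), H. Qed.

Lemma Cmod_lt_of_ball (z w : C) (eps : R) :
  ball (M := C_UniformSpace) z eps w -> (Cmod (w - z) < 2 * eps)%R.
Proof.
  intros [b1 b2]. change (Rabs (fst (w - z)%C) < eps)%R in b1. change (Rabs (snd (w - z)%C) < eps)%R in b2.
  apply Rle_lt_trans with (1 := Cmod_2Rmax _).
  assert (sqrt 2 <= 2)%R by (rewrite <- (sqrt_square 2) at 2 by lra; apply sqrt_le_1; lra).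
  assert (0 <= Rmax (Rabs (fst (w - z)%C)) (Rabs (snd (w - z)%C)) < eps)%R.
  { split; [apply Rle_trans with (2 := Rmax_l _ _), Rabs_pos | apply Rmax_lub_lt; assumption]. }
  nra.
Qed.

(** Compactness of a closed rectangle. *)
Lemma bounded_on_rect (F : R -> R -> C) (a b c d : R) :
  (forall p, continuous (fun p : R * R => F (fst p) (snd p)) p) ->
  exists B, forall x y, (a <= x <= b)%R -> (c <= y <= d)%R -> (Cmod (F x y) <= B)%R.
Proof.
  intros H.
  assert (L : forall u v, exists e : posreal, forall x y,
     (Rabs (x - u) < e)%R -> (Rabs (y - v) < e)%R -> (Cmod (F x y) <= / e)%R).
  { intros u v. destruct (proj1 (filterlim_locally _ _) (H (u, v)) (mkposreal 1 Rlt_0_1)) as [e He].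
    simpl in He.
    assert (P : (0 < Rmin e (/ (Cmod (F u v) + 3)))%R).
    { apply Rmin_pos; [apply cond_pos | ]. apply Rinv_0_lt_compat.
      pose proof (Cmod_ge_0 (F u v)). lra. }
    exists (mkposreal _ P). simpl. intros x y Hx Hy.
    assert (Hb : ball (M := C_R_NormedModule) (F u v) 1 (F x y)).
    { apply (He (x, y)); split; simpl.
      - apply Rlt_le_trans with (1 := Hx), Rmin_l.
      - apply Rlt_le_trans with (1 := Hy), Rmin_l. }
    apply Rle_trans with (Cmod (F u v) + 3)%R.
    - apply Cmod_lt_of_ball in Hb.
      replace (F x y) with (F u v + (F x y - F u v)) by ring.
      apply Rle_trans with (1 := Cmod_triangle _ _). lra.
    - rewrite <- (Rinv_inv (Cmod (F u v) + 3)) at 1. apply Rinv_le_contravar; [exact P | apply Rmin_r]. }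
  (* A local bound is recorded as 1 / delta, so that a positive lower bound on the radii
     of a cover bounds F. *)
  set (delta := fun u v => proj1_sig (constructive_indefinite_description _ (L u v))).
  destruct (compactness_value_2d a b c d delta) as [e He].
  exists (/ e)%R. intros x y Hx Hy.
  destruct (Rle_lt_dec (Cmod (F x y)) (/ e)) as [Hl | Hl]; [exact Hl | exfalso].
  apply (He x y Hx Hy). intros (u & v & _ & _ & Hu & Hv & Hd).
  pose proof (proj2_sig (constructive_indefinite_description _ (L u v)) x y Hu Hv) as Q.
  fold (delta u v) in Q.
  assert (/ delta u v <= / e)%R by (apply Rinv_le_contravar; [apply cond_pos | exact Hd]).
  unfold delta in *. lra.
Qed.

(** Chain rule along a plane curve. *)
Lemma is_derive_comp2 (F Fx : R -> R -> R) (Fy : R) (al be : R -> R) (s la lb : R) :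
  locally (al s, be s) (fun u : R * R => is_derive (fun z => F z (snd u)) (fst u) (Fx (fst u) (snd u))) ->
  is_derive (F (al s)) (be s) Fy ->
  continuous (fun u : R * R => Fx (fst u) (snd u)) (al s, be s) ->
  is_derive al s la -> is_derive be s lb ->
  is_derive (fun s => F (al s) (be s)) s (la * Fx (al s) (be s) + lb * Fy)%R.
Proof.
  intros H1 H2 H3 Ha Hb.
  apply (filterdiff_ext_lin (K := R_AbsRing) (U := R_NormedModule) (V := R_NormedModule)
    (fun s => F (al s) (be s)) (fun y : R => plus (scal (scal y la) (Fx (al s) (be s))) (scal (scal y lb) Fy)%R)).
  - apply (filterdiff_comp'_2 (K := R_AbsRing) (T := R_NormedModule) (U := R_NormedModule)
      (V := R_NormedModule) (W := R_NormedModule) al be F s (fun y => scal y la) (fun y => scal y lb)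
      (fun u v => plus (scal u (Fx (al s) (be s))) (scal v Fy)) Ha Hb).
    apply (is_derive_filterdiff F (al s) (be s) Fx Fy H1 H2 H3).
  - intros y. unfold plus, scal; simpl; unfold mult; simpl. ring.
Qed.

Lemma is_derive_C_comp2 (F Fx : R -> R -> C) (Fy : C) (al be : R -> R) (s la lb : R) :
  locally (al s, be s) (fun u : R * R => is_derive_C (fun z => F z (snd u)) (fst u) (Fx (fst u) (snd u))) ->
  is_derive_C (F (al s)) (be s) Fy ->
  continuous (fun u : R * R => Fx (fst u) (snd u)) (al s, be s) ->
  is_derive al s la -> is_derive be s lb ->
  is_derive_C (fun s => F (al s) (be s)) s (RtoC la * Fx (al s) (be s) + RtoC lb * Fy).
Proof.
  intros H1 H2 H3 Ha Hb.
  apply is_derive_C_Re_Im in H2. apply continuous_C_Re_Im in H3.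
  apply is_derive_C_Re_Im; split.
  - evar_last.
    + apply (is_derive_comp2 (fun x y => Re (F x y)) (fun x y => Re (Fx x y)) (Re Fy) al be s la lb); try tauto.
      revert H1. apply filter_imp. intros u Hu. apply (proj1 (is_derive_C_Re_Im _ _ _) Hu).
    + unfold Re; simpl; ring.
  - evar_last.
    + apply (is_derive_comp2 (fun x y => Im (F x y)) (fun x y => Im (Fx x y)) (Im Fy) al be s la lb); try tauto.
      revert H1. apply filter_imp. intros u Hu. apply (proj1 (is_derive_C_Re_Im _ _ _) Hu).
    + unfold Im; simpl; ring.
Qed.

Lemma locally_open_rect (a b c d x y : R) :
  (a < x < b)%R -> (c < y < d)%R ->
  locally (x, y) (fun u : R * R => (a < fst u < b)%R /\ (c < snd u < d)%R).
Proof.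
  intros Hx Hy.
  destruct (locally_open_interval _ _ _ Hx) as [e1 H1], (locally_open_interval _ _ _ Hy) as [e2 H2].
  exists (mkposreal _ (Rmin_pos e1 e2 (cond_pos e1) (cond_pos e2))). intros u [b1 b2].
  split; [apply H1 | apply H2].
  - apply (ball_le (M := R_UniformSpace) x _ _ (Rmin_l e1 e2)), b1.
  - apply (ball_le (M := R_UniformSpace) y _ _ (Rmin_r e1 e2)), b2.
Qed.

(** Schwarz' theorem, for partial derivatives given as functions on an open
    rectangle. *)
Lemma mixed_partials_real (f fx fy fxy fyx : R -> R -> R) (a b c d : R) :
  (forall x y, a < x < b -> c < y < d ->
     is_derive (fun z => f z y) x (fx x y) /\ is_derive (f x) y (fy x y) /\
     is_derive (fx x) y (fxy x y) /\ is_derive (fun z => fy z y) x (fyx x y))%R ->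
  (forall x y, a < x < b -> c < y < d -> continuity_2d_pt fxy x y)%R ->
  (forall x y, a < x < b -> c < y < d -> continuity_2d_pt fyx x y)%R ->
  (forall x y, a < x < b -> c < y < d -> fxy x y = fyx x y)%R.
Proof.
  intros H C1 C2 x y Hx Hy.
  assert (Ex : forall x y, (a < x < b)%R -> (c < y < d)%R ->
     is_derive (fun z => Derive (fun t => f t z) x) y (fxy x y)).
  { intros u v Hu Hv. apply (is_derive_ext_loc (fx u)); [ | apply H; assumption].
    apply (filter_imp _ _) with (2 := locally_open_interval _ _ _ Hv).
    intros z Hz. symmetry. apply is_derive_unique, H; assumption. }
  assert (Ey : forall x y, (a < x < b)%R -> (c < y < d)%R ->
     is_derive (fun z => Derive (fun t => f z t) y) x (fyx x y)).
  { intros u v Hu Hv. apply (is_derive_ext_loc (fun z => fy z v)); [ | apply H; assumption].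
    apply (filter_imp _ _) with (2 := locally_open_interval _ _ _ Hu).
    intros z Hz. symmetry. apply is_derive_unique, H; assumption. }
  rewrite <- (is_derive_unique _ _ _ (Ex x y Hx Hy)), <- (is_derive_unique _ _ _ (Ey x y Hx Hy)).
  symmetry. apply Schwarz.
  - apply locally_2d_locally. apply filter_imp with (2 := locally_open_rect _ _ _ _ _ _ Hx Hy).
    intros [u v] [Hu Hv]; simpl in *. destruct (H u v Hu Hv) as (h1 & h2 & _).
    repeat split; eexists; [exact h1 | exact h2 | apply Ey | apply Ex]; assumption.
  - apply (continuity_2d_pt_ext_loc fyx); [ | apply C2; assumption].
    apply locally_2d_locally. apply filter_imp with (2 := locally_open_rect _ _ _ _ _ _ Hx Hy).
    intros [u v] [Hu Hv]; simpl in *. symmetry; apply is_derive_unique, Ey; assumption.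
  - apply (continuity_2d_pt_ext_loc fxy); [ | apply C1; assumption].
    apply locally_2d_locally. apply filter_imp with (2 := locally_open_rect _ _ _ _ _ _ Hx Hy).
    intros [u v] [Hu Hv]; simpl in *. symmetry; apply is_derive_unique, Ex; assumption.
Qed.

Lemma jointly_continuous_2d_pt F x y : jointly_continuous F ->
  continuity_2d_pt (fun u v => Re (F u v)) x y /\ continuity_2d_pt (fun u v => Im (F u v)) x y.
Proof.
  intros H. destruct (proj1 (continuous_C_Re_Im _ _) (H (x, y))) as [h1 h2].
  split; apply continuity_2d_pt_filterlim; assumption.
Qed.

(** Symmetry of mixed partial derivatives of complex-valued functions. *)
Lemma mixed_partials (f fx fy fxy fyx : R -> R -> C) (a b c d : R) :
  (forall x y, (a < x < b)%R -> (c < y < d)%R ->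
     is_derive_C (fun z => f z y) x (fx x y) /\ is_derive_C (f x) y (fy x y) /\
     is_derive_C (fx x) y (fxy x y) /\ is_derive_C (fun z => fy z y) x (fyx x y)) ->
  jointly_continuous fxy -> jointly_continuous fyx ->
  (forall x y, (a < x < b)%R -> (c < y < d)%R -> fxy x y = fyx x y).
Proof.
  intros H C1 C2 x y Hx Hy. apply injective_projections.
  - apply (mixed_partials_real (fun x y => Re (f x y)) (fun x y => Re (fx x y)) (fun x y => Re (fy x y))
      (fun x y => Re (fxy x y)) (fun x y => Re (fyx x y)) a b c d); try assumption;
    intros u v Hu Hv; try (apply jointly_continuous_2d_pt; assumption).
    destruct (H u v Hu Hv) as (h1 & h2 & h3 & h4). rewrite is_derive_C_Re_Im in h1, h2, h3, h4. tauto.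
  - apply (mixed_partials_real (fun x y => Im (f x y)) (fun x y => Im (fx x y)) (fun x y => Im (fy x y))
      (fun x y => Im (fxy x y)) (fun x y => Im (fyx x y)) a b c d); try assumption;
    intros u v Hu Hv; try (apply jointly_continuous_2d_pt; assumption).
    destruct (H u v Hu Hv) as (h1 & h2 & h3 & h4). rewrite is_derive_C_Re_Im in h1, h2, h3, h4. tauto.
Qed.

(** * Integrals depending on a parameter *)

Lemma continuous_RInt_param_real (K : R -> R -> R) (a b x : R) :
  (a <= b)%R -> (forall x y, continuity_2d_pt K x y) ->
  continuous (fun x => RInt (K x) a b) x.
Proof.
  intros Hab HK.
  assert (Hex : forall x, ex_RInt (K x) a b).
  { intros u. apply (ex_RInt_continuous (V := R_CompleteNormedModule)). intros z _.
    apply (continuous_comp_2 (fun _ : R => u) (fun v : R => v) K).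
    - apply continuous_const.
    - apply continuous_id.
    - apply continuity_2d_pt_filterlim, HK. }
  apply filterlim_locally. intros eps.
  assert (P : (0 < eps / (2 * (b - a + 1)))%R).
  { apply Rdiv_lt_0_compat; [apply cond_pos | lra]. }
  destruct (uniform_continuity_2d_1d' K a b x (fun y _ => HK x y) (mkposreal _ P)) as [d Hd].
  exists d. intros y Hy. change (Rabs (y - x) < d)%R in Hy.
  change (Rabs (minus (RInt (K y) a b) (RInt (K x) a b)) < eps)%R.
  rewrite <- (RInt_minus (V := R_CompleteNormedModule)) by apply Hex.
  apply Rle_lt_trans with ((b - a) * (eps / (2 * (b - a + 1))))%R.
  - apply abs_RInt_le_const; [exact Hab | apply (ex_RInt_minus (V := R_NormedModule)); apply Hex | ].
    intros t Ht. apply Rlt_le. apply Hd; try assumption.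
    + pose proof (cond_pos d). lra.
    + apply Rabs_def2 in Hy. lra.
    + rewrite Rminus_diag, Rabs_R0. apply cond_pos.
  - apply Rlt_le_trans with ((b - a + 1) * (eps / (2 * (b - a + 1))))%R.
    + apply Rmult_lt_compat_r; [exact P | lra].
    + pose proof (cond_pos eps).
      replace ((b - a + 1) * (eps / (2 * (b - a + 1))))%R with (eps / 2)%R by (field; lra). lra.
Qed.

Lemma continuous_RInt_param (K : R -> R -> C) (a b x : R) :
  (a <= b)%R -> jointly_continuous K -> continuous (fun x => RInt_C (K x) a b) x.
Proof.
  intros Hab HK.
  apply (continuous_ext (fun x => (RInt (fun y => Re (K x y)) a b, RInt (fun y => Im (K x y)) a b))).
  { intros u. symmetry. apply RInt_C_Re_Im. intros v _. apply jointly_continuous_slice, HK. }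
  apply (continuous_C_Re_Im (fun x => (RInt (fun y => Re (K x y)) a b, RInt (fun y => Im (K x y)) a b))); split.
  - apply (continuous_RInt_param_real (fun x y => Re (K x y)) a b x Hab).
    intros; apply jointly_continuous_2d_pt, HK.
  - apply (continuous_RInt_param_real (fun x y => Im (K x y)) a b x Hab).
    intros; apply jointly_continuous_2d_pt, HK.
Qed.

Lemma is_derive_RInt_param_real (K Kx : R -> R -> R) (a b l u x : R) :
  (l < x < u)%R ->
  (forall x y, (l < x < u)%R -> is_derive (fun z => K z y) x (Kx x y)) ->
  (forall x y, continuity_2d_pt K x y) -> (forall x y, continuity_2d_pt Kx x y) ->
  is_derive (fun x => RInt (K x) a b) x (RInt (Kx x) a b).
Proof.
  intros Hx HD HK HKx.
  rewrite (RInt_ext (Kx x) (fun y => Derive (fun z => K z y) x)).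
  2: { intros y _. symmetry. apply is_derive_unique, HD, Hx. }
  apply is_derive_RInt_param.
  - apply filter_imp with (2 := locally_open_interval _ _ _ Hx). intros z Hz t _.
    eexists; apply HD, Hz.
  - intros t _. apply (continuity_2d_pt_ext_loc Kx); [ | apply HKx].
    apply locally_2d_locally.
    apply filter_imp with (2 := locally_open_rect _ _ (t - 1) (t + 1) _ t Hx ltac:(lra)).
    intros [v w] [Hv _]; simpl in *. symmetry; apply is_derive_unique, HD, Hv.
  - apply filter_forall. intros y. apply (ex_RInt_continuous (V := R_CompleteNormedModule)). intros z _.
    apply (continuous_comp_2 (fun _ : R => y) (fun v : R => v) K).
    + apply continuous_const.
    + apply continuous_id.
    + apply continuity_2d_pt_filterlim, HK.
Qed.

Lemma is_derive_C_RInt_param (K Kx : R -> R -> C) (a b l u x : R) :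
  (l < x < u)%R ->
  (forall x y, (l < x < u)%R -> is_derive_C (fun z => K z y) x (Kx x y)) ->
  jointly_continuous K -> jointly_continuous Kx ->
  is_derive_C (fun x => RInt_C (K x) a b) x (RInt_C (Kx x) a b).
Proof.
  intros Hx HD HK HKx.
  apply (is_derive_ext (V := C_R_NormedModule)
    (fun x => (RInt (fun y => Re (K x y)) a b, RInt (fun y => Im (K x y)) a b))).
  { intros v. symmetry. apply RInt_C_Re_Im. intros w _. apply jointly_continuous_slice, HK. }
  rewrite (RInt_C_Re_Im (Kx x)) by (intros w _; apply jointly_continuous_slice, HKx).
  apply (is_derive_C_Re_Im (fun x => (RInt (fun y => Re (K x y)) a b, RInt (fun y => Im (K x y)) a b))); split.
  - apply (is_derive_RInt_param_real (fun x y => Re (K x y)) (fun x y => Re (Kx x y)) a b l u x Hx);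
    intros; try (apply jointly_continuous_2d_pt; assumption).
    apply (is_derive_C_Re_Im (fun z => K z y)), HD; assumption.
  - apply (is_derive_RInt_param_real (fun x y => Im (K x y)) (fun x y => Im (Kx x y)) a b l u x Hx);
    intros; try (apply jointly_continuous_2d_pt; assumption).
    apply (is_derive_C_Re_Im (fun z => K z y)), HD; assumption.
Qed.

(** * Uniqueness for a Goursat system *)

(** The point of abscissa x on the characteristic (1 - t) r^2 = c^2 has
    t = 1 - (c / x)^2. *)
Lemma characteristic_point c x : (0 < c < x)%R -> (0 < 1 - (c / x) ^ 2 < 1)%R.
Proof.
  intros Hc. assert (0 < c / x < 1)%R; [ | nra].
  split; [apply Rdiv_lt_0_compat; lra | ].
  apply Rmult_lt_reg_r with x; [lra | ]. field_simplify; lra.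
Qed.

(** One step of the contraction: the weight exp (lam * r) is chosen so that a bound
    on [P] of size m r exp (lam * r) improves by a factor 2. The hypothesis on
    P / x^2 is the transport equation for [P] along the characteristics. *)
Lemma gronwall_step (P Q : R -> R -> C) (a : R -> C) (rho A m : R) :
  (0 <= m)%R ->
  jointly_continuous P -> jointly_continuous Q ->
  (forall r, (0 < r < rho)%R -> (Cmod (a r) <= A)%R) ->
  (forall r t, (0 < r < rho)%R -> (0 < t < 1)%R ->
     is_derive_C (fun x => Q x t) r (a r * P r t)) ->
  (forall c s, (0 < c < s)%R -> (s < rho)%R ->
     is_derive_C (fun x => RtoC (/ x ^ 2) * P x (1 - (c / x) ^ 2)%R) s
        (RtoC (/ s ^ 2) * (a s * Q s (1 - (c / s) ^ 2)%R))) ->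
  (forall r, (0 < r < rho)%R -> P r 0%R = 0) ->
  (forall t, (0 < t < 1)%R -> Q 0%R t = 0) ->
  let lam := (rho * A ^ 2 + 1)%R in
  (forall r t, (0 < r < rho)%R -> (0 < t < 1)%R ->
     (Cmod (P r t) <= m * r * exp (lam * r))%R) ->
  forall r t, (0 < r < rho)%R -> (0 < t < 1)%R ->
     (Cmod (Q r t) <= A * m * exp (lam * r) * r ^ 2 / 2)%R /\
     (Cmod (P r t) <= m / 2 * r * exp (lam * r))%R.
Proof.
  intros Hm cP cQ HA HQ HP P0 Q0 lam Hb.
  assert (HQb : forall r t, (0 < r < rho)%R -> (0 < t < 1)%R ->
     (Cmod (Q r t) <= A * m * exp (lam * r) * r ^ 2 / 2)%R).
  { intros r t Hr Ht.
    assert (HA0 : (0 <= A)%R) by (apply Rle_trans with (2 := HA r Hr), Cmod_ge_0).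
    assert (Hlam : (0 < lam)%R) by (unfold lam; nra).
    pose proof (Cmod_increment_le (fun x => Q x t) (fun x => a x * P x t)
      (fun x => A * m * exp (lam * r) * x ^ 2 / 2)%R (fun x => A * m * exp (lam * r) * x)%R 0 r) as I.
    cbv beta in I. rewrite (Q0 t Ht) in I.
    replace (Q r t) with (Q r t - 0) by ring.
    replace (A * m * exp (lam * r) * r ^ 2 / 2)%R with
      (A * m * exp (lam * r) * r ^ 2 / 2 - A * m * exp (lam * r) * 0 ^ 2 / 2)%R by field.
    apply I; clear I.
    - lra.
    - intros x Hx. apply HQ; lra.
    - intros x _. apply (continuous_curve Q (fun x => x) (fun _ => t)); [exact cQ | apply continuous_id | apply continuous_const].
    - intros x _. auto_derive; [exact I | field].
    - intros x Hx. rewrite Cmod_mult.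
      apply Rle_trans with (A * (m * x * exp (lam * x)))%R.
      + apply Rmult_le_compat; try apply Cmod_ge_0; [apply HA; lra | apply Hb; lra].
      + assert (exp (lam * x) <= exp (lam * r))%R.
        { apply Rlt_le, exp_increasing. apply Rmult_lt_compat_l; lra. }
        assert (0 <= A * m * x)%R by (repeat apply Rmult_le_pos; lra).
        nra. }
  intros r t Hr Ht. split; [apply HQb; assumption | ].
  assert (HA0 : (0 <= A)%R) by (apply Rle_trans with (2 := HA r Hr), Cmod_ge_0).
  assert (Hlam : (0 < lam)%R) by (unfold lam; nra).
  (* The characteristic through (r, t) leaves the axis t = 0 at (c, 0). *)
  set (c := (r * sqrt (1 - t))%R).
  assert (Hs0 : (0 < sqrt (1 - t))%R) by (apply sqrt_lt_R0; lra).
  assert (Hs1 : (sqrt (1 - t) < 1)%R) by (rewrite <- sqrt_1 at 2; apply sqrt_lt_1; lra).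
  assert (Hc : (0 < c < r)%R) by (unfold c; split; [apply Rmult_lt_0_compat; lra | rewrite <- (Rmult_1_r r) at 2; apply Rmult_lt_compat_l; lra]).
  assert (Er : (1 - (c / r) ^ 2 = t)%R).
  { replace (c / r)%R with (sqrt (1 - t)) by (unfold c; field; lra).
    simpl. rewrite Rmult_1_r, sqrt_sqrt; lra. }
  assert (Ec : (1 - (c / c) ^ 2 = 0)%R) by (field; lra).
  pose proof (Cmod_increment_le (fun x => RtoC (/ x ^ 2) * P x (1 - (c / x) ^ 2)%R)
    (fun s => RtoC (/ s ^ 2) * (a s * Q s (1 - (c / s) ^ 2)%R))
    (fun s => A ^ 2 * m * exp (lam * s) / (2 * lam))%R (fun s => A ^ 2 * m * exp (lam * s) / 2)%R c r) as I.
  cbv beta in I. rewrite Er, Ec, P0 in I by lra.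
  assert (I' : (Cmod (RtoC (/ r ^ 2) * P r t) <= A ^ 2 * m * exp (lam * r) / (2 * lam))%R).
  { replace (RtoC (/ r ^ 2) * P r t) with (RtoC (/ r ^ 2) * P r t - RtoC (/ c ^ 2) * 0) by ring.
    eapply Rle_trans; [apply I; clear I | ].
    - lra.
    - intros x Hx. apply HP; lra.
    - intros x Hx. apply continuous_Cmult.
      + apply continuous_RtoC. apply (ex_derive_continuous (V := R_NormedModule)). auto_derive. nra.
      + apply (continuous_curve P (fun x => x) (fun x => 1 - (c / x) ^ 2)%R); [exact cP | apply continuous_id | ].
        apply (ex_derive_continuous (V := R_NormedModule)). auto_derive. lra.
    - intros x _. auto_derive; [exact I | field; lra].
    - intros x Hx. rewrite !Cmod_mult, Cmod_R.
      assert (Hx2 : (0 < x ^ 2)%R) by nra.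
      rewrite Rabs_pos_eq by (apply Rlt_le, Rinv_0_lt_compat, Hx2).
      apply Rle_trans with (/ x ^ 2 * (A * (A * m * exp (lam * x) * x ^ 2 / 2)))%R.
      + apply Rmult_le_compat_l; [apply Rlt_le, Rinv_0_lt_compat, Hx2 | ].
        apply Rmult_le_compat; try apply Cmod_ge_0; [apply HA; lra | ].
        apply HQb; [lra | ].
        apply characteristic_point; lra.
      + apply Req_le. field. lra.
    - assert (0 <= A ^ 2 * m * exp (lam * c) / (2 * lam))%R.
      { apply Rmult_le_pos; [ | apply Rlt_le, Rinv_0_lt_compat; lra].
        pose proof (exp_pos (lam * c)). assert (0 <= A ^ 2)%R by nra.
        repeat apply Rmult_le_pos; lra. }
      lra. }
  rewrite Cmod_mult, Cmod_R in I'.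
  assert (Hr2 : (0 < r ^ 2)%R) by nra.
  rewrite Rabs_pos_eq in I' by (apply Rlt_le, Rinv_0_lt_compat, Hr2).
  apply Rmult_le_compat_l with (r := (r ^ 2)%R) in I'; [ | lra].
  rewrite <- Rmult_assoc, Rinv_r, Rmult_1_l in I' by lra.
  apply Rle_trans with (1 := I').
  replace (r ^ 2 * (A ^ 2 * m * exp (lam * r) / (2 * lam)))%R with
    (m / 2 * r * exp (lam * r) * ((r * A ^ 2) / lam))%R by (field; lra).
  rewrite <- (Rmult_1_r (m / 2 * r * exp (lam * r))) at 2.
  apply Rmult_le_compat_l.
  - pose proof (exp_pos (lam * r)). repeat apply Rmult_le_pos; lra.
  - apply Rmult_le_reg_r with lam; [exact Hlam | ].
    replace (r * A ^ 2 / lam * lam)%R with (r * A ^ 2)%R by (field; lra).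
    unfold lam. assert (0 <= A ^ 2)%R by nra. nra.
Qed.

(** Uniqueness for the system Q_r = a P, r P_r + 2 (1 - t) P_t - 2 P = r a Q with
    zero data on the axes, among pairs with P = O(r). *)
Lemma goursat_system_uniqueness (P Q : R -> R -> C) (a : R -> C) (rho A m : R) :
  (0 <= m)%R ->
  jointly_continuous P -> jointly_continuous Q ->
  (forall r, (0 < r < rho)%R -> (Cmod (a r) <= A)%R) ->
  (forall r t, (0 < r < rho)%R -> (0 < t < 1)%R ->
     is_derive_C (fun x => Q x t) r (a r * P r t)) ->
  (forall c s, (0 < c < s)%R -> (s < rho)%R ->
     is_derive_C (fun x => RtoC (/ x ^ 2) * P x (1 - (c / x) ^ 2)%R) s
        (RtoC (/ s ^ 2) * (a s * Q s (1 - (c / s) ^ 2)%R))) ->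
  (forall r, (0 < r < rho)%R -> P r 0%R = 0) ->
  (forall t, (0 < t < 1)%R -> Q 0%R t = 0) ->
  (forall r t, (0 < r < rho)%R -> (0 < t < 1)%R -> (Cmod (P r t) <= m * r)%R) ->
  forall r t, (0 < r < rho)%R -> (0 < t < 1)%R -> P r t = 0 /\ Q r t = 0.
Proof.
  intros Hm cP cQ HA HQ HP P0 Q0 Hb r t Hr Ht.
  set (lam := (rho * A ^ 2 + 1)%R).
  assert (Hlam : (0 < lam)%R).
  { assert (0 <= A)%R by (apply Rle_trans with (2 := HA r Hr), Cmod_ge_0). unfold lam; nra. }
  assert (Hn : forall n r t, (0 < r < rho)%R -> (0 < t < 1)%R ->
     (Cmod (P r t) <= m / 2 ^ n * r * exp (lam * r))%R).
  { induction n as [ | n IH]; intros x y Hx Hy.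
    - apply Rle_trans with (1 := Hb x y Hx Hy). simpl. rewrite Rdiv_1_r.
      rewrite <- (Rmult_1_r (m * x)) at 1. apply Rmult_le_compat_l; [nra | ].
      rewrite <- exp_0. apply Rlt_le, exp_increasing. nra.
    - replace (m / 2 ^ S n)%R with (m / 2 ^ n / 2)%R by (simpl; field; apply pow_nonzero; lra).
      apply (gronwall_step P Q a rho A (m / 2 ^ n)%R); try assumption.
      apply Rmult_le_pos; [exact Hm | apply Rlt_le, Rinv_0_lt_compat, pow_lt; lra]. }
  assert (Pz : forall r t, (0 < r < rho)%R -> (0 < t < 1)%R -> (Cmod (P r t) <= 0)%R).
  { intros x y Hx Hy. apply Rnot_lt_le. intros Hpos.
    assert (K0 : (0 <= m * x * exp (lam * x))%R).
    { pose proof (exp_pos (lam * x)). repeat apply Rmult_le_pos; lra. }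
    destruct (pow_lt_1_zero (/ 2) ltac:(rewrite Rabs_pos_eq; lra) (Cmod (P x y) / (m * x * exp (lam * x) + 1))%R) as [n Hnn].
    { apply Rdiv_lt_0_compat; lra. }
    specialize (Hnn n (Nat.le_refl n)). specialize (Hn n x y Hx Hy).
    rewrite Rabs_pos_eq in Hnn by (apply pow_le; lra).
    rewrite pow_inv in Hnn.
    replace (m / 2 ^ n * x * exp (lam * x))%R with (/ 2 ^ n * (m * x * exp (lam * x)))%R in Hn
      by (field; apply pow_nonzero; lra).
    apply Rmult_lt_compat_r with (r := (m * x * exp (lam * x) + 1)%R) in Hnn; [ | lra].
    replace (Cmod (P x y) / (m * x * exp (lam * x) + 1) * (m * x * exp (lam * x) + 1))%R
      with (Cmod (P x y)) in Hnn by (field; lra).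
    assert (0 < / 2 ^ n)%R by (apply Rinv_0_lt_compat, pow_lt; lra). lra. }
  destruct (gronwall_step P Q a rho A 0 (Rle_refl 0) cP cQ HA HQ HP P0 Q0) with (r := r) (t := t)
    as [B1 B2]; try assumption.
  { intros x y Hx Hy. rewrite !Rmult_0_l. apply Pz; assumption. }
  split; apply Cmod_eq_0.
  - apply Rle_antisym; [apply Pz; assumption | apply Cmod_ge_0].
  - apply Rle_antisym; [ | apply Cmod_ge_0]. apply Rle_trans with (1 := B1). lra.
Qed.

(** * Extension of kernels to the plane *)

(** Extension of a function on [0, rho] x [0, 1] to the plane, by projection. *)
Definition plane_extension (rho : R) (F : R -> R -> C) (r t : R) : C :=
  F (clamp 0 rho r) (clamp 0 1 t).

(** The hypothesis gives continuity of the partial derivatives only; joint continuity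
    follows, as [G] is continuous in t and Lipschitz in r uniformly in t. *)
Lemma jointly_continuous_C1_rect rho (G Gr Gt : R -> R -> C) :
  (0 < rho)%R -> is_C1_rect rho G Gr Gt -> jointly_continuous (plane_extension rho G).
Proof.
  intros Hrho [HD [cr ct]] [r t].
  assert (Jr : jointly_continuous (plane_extension rho Gr)).
  { intros p. apply continuous_on_clamp_rect; [lra | exact cr]. }
  destruct (bounded_on_rect _ 0 rho 0 1 Jr) as [B HB].
  assert (HB' : forall x y, (0 <= x <= rho)%R -> (0 <= y <= 1)%R -> (Cmod (Gr x y) <= B)%R).
  { intros x y Hx Hy. specialize (HB x y Hx Hy). unfold plane_extension in HB.
    rewrite !clamp_id in HB by assumption. exact HB. }
  assert (HB0 : (0 <= B)%R).
  { apply Rle_trans with (2 := HB' 0%R 0%R ltac:(lra) ltac:(lra)), Cmod_ge_0. }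
  assert (Lip : forall x x' y, (0 <= x)%R -> (x <= x')%R -> (x' <= rho)%R -> (0 <= y <= 1)%R ->
     (Cmod (G x' y - G x y) <= B * (x' - x))%R).
  { intros x x' y H0 H1 H2 Hy.
    pose proof (Cmod_increment_le (fun z => G (clamp 0 rho z) y) (fun z => Gr z y)
      (fun z => B * z)%R (fun _ => B) x x') as I. cbv beta in I.
    rewrite !clamp_id in I by lra. rewrite Rmult_minus_distr_l. apply I.
    - exact H1.
    - intros z Hz. apply (is_derive_C_clamp 0 rho (fun z => G z y)); [lra | ].
      apply HD; unfold Icc; lra.
    - intros z _. apply (continuous_on_clamp 0 rho (fun z => G z y)); [lra | ].
      apply (continuous_on_of_derive _ _ (fun z => Gr z y)). intros w Hw. apply HD; assumption.
    - intros z _. auto_derive; [exact Logic.I | ring].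
    - intros z Hz. apply HB'; lra. }
  assert (Ct : continuous (plane_extension rho G r) t).
  { apply (continuous_on_clamp 0 1 (fun y => G (clamp 0 rho r) y)); [lra | ].
    apply (continuous_on_of_derive _ _ (fun y => Gt (clamp 0 rho r) y)).
    intros w Hw. apply HD; [apply clamp_in; lra | exact Hw]. }
  apply filterlim_locally. intros eps. simpl.
  destruct (proj1 (filterlim_locally _ _) Ct (pos_div_2 (pos_div_2 eps))) as [d Hd].
  assert (Pd : (0 < Rmin d (eps / (2 * (B + 1))))%R).
  { apply Rmin_pos; [apply cond_pos | apply Rdiv_lt_0_compat; [apply cond_pos | lra]]. }
  exists (mkposreal _ Pd). intros [x y] [Hx Hy]. simpl in Hx, Hy |- *.
  apply C_NormedModule_mixin_compat1.
  change (Cmod (plane_extension rho G x y - plane_extension rho G r t) < eps)%R.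
  replace (plane_extension rho G x y - plane_extension rho G r t) with
    ((plane_extension rho G x y - plane_extension rho G r y) +
     (plane_extension rho G r y - plane_extension rho G r t)) by ring.
  apply Rle_lt_trans with (1 := Cmod_triangle _ _).
  assert (B1 : (Cmod (plane_extension rho G x y - plane_extension rho G r y) < eps / 2)%R).
  { apply Rle_lt_trans with (B * Rabs (x - r))%R.
    - apply Rle_trans with (B * Rabs (clamp 0 rho x - clamp 0 rho r))%R;
        [ | apply Rmult_le_compat_l; [exact HB0 | apply clamp_lipschitz]].
      unfold plane_extension.
      pose proof (clamp_in 0 rho x ltac:(lra)). pose proof (clamp_in 0 rho r ltac:(lra)).
      pose proof (clamp_in 0 1 y ltac:(lra)).
      destruct (Rle_dec (clamp 0 rho r) (clamp 0 rho x)).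
      + rewrite Rabs_pos_eq by lra. apply Lip; lra.
      + rewrite Rabs_left by lra. rewrite Ropp_minus_distr, <- Cmod_opp, Copp_minus_distr.
        apply Lip; lra.
    - assert (Hx' : (Rabs (x - r) < eps / (2 * (B + 1)))%R).
      { apply Rlt_le_trans with (1 := Hx), Rmin_r. }
      apply Rle_lt_trans with ((B + 1) * Rabs (x - r))%R.
      + apply Rmult_le_compat_r; [apply Rabs_pos | lra].
      + replace (eps / 2)%R with ((B + 1) * (eps / (2 * (B + 1))))%R by (field; lra).
        apply Rmult_lt_compat_l; [lra | exact Hx']. }
  assert (B2 : (Cmod (plane_extension rho G r y - plane_extension rho G r t) < eps / 2)%R).
  { specialize (Hd y). simpl in Hd.
    assert (Hy' : ball (M := R_UniformSpace) t d y).
    { apply Rlt_le_trans with (1 := Hy), Rmin_l. }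
    specialize (Hd Hy').
    apply Cmod_lt_of_ball in Hd. lra. }
  lra.
Qed.

(* Unification diverges when it unfolds these in order to compare distinct functions. *)
#[local] Opaque is_derive continuous.

(** A solution of the kernel equation with potential [q], with its partial derivatives
    in r and t, all defined on the whole plane. The functions are continuous
    everywhere, while derivatives and equation are only required where they make
    sense for a function on [0, rho] x [0, 1] extended by projection: r-derivatives
    for 0 < r < rho, t-derivatives for 0 < t < 1. The symmetry of the mixed
    derivatives is built in: [Grt] is the derivative of [Gr] in t and of [Gt] in r. *)
Record plane_kernel (rho : R) (q : R -> C) (G Gr Gt Grr Grt : R -> R -> C) : Prop := {
  pk_cont : jointly_continuous G;
  pk_cont_r : jointly_continuous Gr;
  pk_cont_t : jointly_continuous Gt;
  pk_cont_rr : jointly_continuous Grr;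
  pk_r : forall r t, (0 < r < rho)%R -> is_derive_C (fun x => G x t) r (Gr r t);
  pk_t : forall r t, (0 < t < 1)%R -> is_derive_C (G r) t (Gt r t);
  pk_rr : forall r t, (0 < r < rho)%R -> is_derive_C (fun x => Gr x t) r (Grr r t);
  pk_rt : forall r t, (0 < t < 1)%R -> is_derive_C (Gr r) t (Grt r t);
  pk_tr : forall r t, (0 < r < rho)%R -> (0 < t < 1)%R -> is_derive_C (fun x => Gt x t) r (Grt r t);
  pk_eq : forall r t, (0 < r < rho)%R -> (0 < t < 1)%R ->
    RtoC r * (Grr r t - q r * G r t) - Gr r t + 2 * (1 - RtoC t) * Grt r t = 0;
  pk_axis : forall r, (0 <= r <= rho)%R -> G r 0%R = RInt_C (fun x => RtoC x * q x) 0 r;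
  pk_zero : forall t, G 0%R t = 0
}.

Arguments pk_cont {rho q G Gr Gt Grr Grt} _.
Arguments pk_cont_r {rho q G Gr Gt Grr Grt} _.
Arguments pk_cont_t {rho q G Gr Gt Grr Grt} _.
Arguments pk_cont_rr {rho q G Gr Gt Grr Grt} _.
Arguments pk_r {rho q G Gr Gt Grr Grt} _.
Arguments pk_t {rho q G Gr Gt Grr Grt} _.
Arguments pk_rr {rho q G Gr Gt Grr Grt} _.
Arguments pk_rt {rho q G Gr Gt Grr Grt} _.
Arguments pk_tr {rho q G Gr Gt Grr Grt} _.
Arguments pk_eq {rho q G Gr Gt Grr Grt} _.
Arguments pk_axis {rho q G Gr Gt Grr Grt} _.
Arguments pk_zero {rho q G Gr Gt Grr Grt} _.

Lemma plane_kernel_of_is_kernel rho (q q' : R -> C) (G : R -> R -> C) :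
  (0 < rho)%R -> (forall x, (0 <= x <= rho)%R -> q' x = q x) -> is_kernel rho q G ->
  exists Gr Gt Grr Grt, plane_kernel rho q' (plane_extension rho G) Gr Gt Grr Grt.
Proof.
  intros Hrho Hq (Gr & Gt & Grr & Grt & Gtr & Gtt & C0 & Cr & Ct & Heq & Hax & Hz).
  set (e := plane_extension rho).
  assert (J : forall F : R -> R -> C, continuous_on (rect rho) (fun p => F (fst p) (snd p)) ->
    jointly_continuous (e F)).
  { intros F HF p. apply continuous_on_clamp_rect; [lra | exact HF]. }
  assert (Dr : forall F Fr Ft, is_C1_rect rho F Fr Ft -> forall r t, (0 < r < rho)%R ->
    is_derive_C (fun x => e F x t) r (e Fr r t)).
  { intros F Fr Ft [HD _] r t Hr. unfold e, plane_extension. rewrite (clamp_id 0 rho r) by lra.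
    apply (is_derive_C_clamp 0 rho (fun x => F x (clamp 0 1 t))); [exact Hr | ].
    apply HD; [unfold Icc; lra | apply clamp_in; lra]. }
  assert (Dt : forall F Fr Ft, is_C1_rect rho F Fr Ft -> forall r t, (0 < t < 1)%R ->
    is_derive_C (e F r) t (e Ft r t)).
  { intros F Fr Ft [HD _] r t Ht. unfold e, plane_extension. rewrite (clamp_id 0 1 t) by lra.
    apply (is_derive_C_clamp 0 1 (fun x => F (clamp 0 rho r) x)); [exact Ht | ].
    apply HD; [apply clamp_in; lra | unfold Icc; lra]. }
  assert (Mix : forall r t, (0 < r < rho)%R -> (0 < t < 1)%R -> e Grt r t = e Gtr r t).
  { apply (mixed_partials (e G) (e Gr) (e Gt)).
    - intros x y Hx Hy. split; [ | split; [ | split]]; [apply (Dr _ _ _ C0) | apply (Dt _ _ _ C0) | apply (Dt _ _ _ Cr) | apply (Dr _ _ _ Ct)]; assumption.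
    - apply J, Cr.
    - apply J, Ct. }
  exists (e Gr), (e Gt), (e Grr), (e Grt). split.
  - apply (jointly_continuous_C1_rect rho G Gr Gt Hrho C0).
  - apply J, C0.
  - apply J, C0.
  - apply J, Cr.
  - apply (Dr _ _ _ C0).
  - apply (Dt _ _ _ C0).
  - apply (Dr _ _ _ Cr).
  - apply (Dt _ _ _ Cr).
  - intros r t Hr Ht. rewrite Mix by assumption. apply (Dr _ _ _ Ct), Hr.
  - intros r t Hr Ht. unfold e, plane_extension. rewrite !clamp_id by lra. rewrite Hq by lra.
    apply Heq; unfold Icc; lra.
  - intros r Hr. unfold e, plane_extension. rewrite !clamp_id by lra. rewrite Hax by exact Hr.
    apply (RInt_ext (V := C_R_CompleteNormedModule)). intros x Hx. rewrite Rmin_left, Rmax_right in Hx by lra. rewrite Hq by lra. reflexivity.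
  - intros t. unfold e, plane_extension. rewrite (clamp_id 0 rho 0) by lra. apply Hz, clamp_in. lra.
Qed.

(** * The relation between the two kernels *)

(** Kernels [G] and [H] with potentials q and 2 a^2 - q, where a is a solution of the
    Riccati equation a' = q - a^2 - a / r, that is a = f'/f. *)
Section DarbouxPair.

Context (rho : R) (q a : R -> C).
Context (G Gr Gt Grr Grt H Hr Ht Hrr Hrt : R -> R -> C).
Context (KG : plane_kernel rho q G Gr Gt Grr Grt).
Context (KH : plane_kernel rho (fun r => 2 * (a r * a r) - q r) H Hr Ht Hrr Hrt).
Context (Hq : forall r, continuous q r) (Ha : forall r, continuous a r).
Context (Hda : forall r, (0 < r < rho)%R -> is_derive_C a r (q r - a r * a r - a r / RtoC r)).

(** By the Riccati equation, 2 r a is a primitive of r (q - (2 a^2 - q)). *)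
Lemma axis_difference r : (0 <= r <= rho)%R -> H r 0%R - G r 0%R = - (2) * RtoC r * a r.
Proof.
  intros Hr'.
  rewrite (pk_axis KH) by exact Hr'. rewrite (pk_axis KG) by exact Hr'.
  set (I := (fun x => RInt_C (fun x => RtoC x * q x) 0 x) : R -> C).
  assert (Cq : forall x, continuous (fun x => RtoC x * q x) x).
  { intros x. continuous_C ltac:(apply Hq). }
  assert (DI : forall x, is_derive_C I x (RtoC x * q x)).
  { intros x. apply (is_derive_C_RInt (fun x => RtoC x * q x) 0 x Cq). }
  assert (I0 : I 0%R = RtoC 0) by (apply (RInt_point (V := C_R_CompleteNormedModule))).
  change (RInt_C (fun x => RtoC x * (2 * (a x * a x) - q x)) 0 r - I r = - (2) * RtoC r * a r).
  clearbody I.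
  rewrite (RInt_C_FTC (fun x => I x - 2 * (RtoC x * a x)) _ 0 r).
  - rewrite I0. ring.
  - lra.
  - intros x Hx. eapply is_derive_C_eq.
    + derive_C ltac:(first [apply DI | apply Hda; lra]).
    + cbv beta. field. apply RtoC_neq0; lra.
  - intros x _. continuous_C ltac:(first [apply Ha | eapply is_derive_C_continuous, DI]).
  - intros x. continuous_C ltac:(first [apply Hq | apply Ha]).
Qed.

Lemma axis_derivative (p : R -> C) (F Fr Ft Frr Frt : R -> R -> C) r :
  (forall r, continuous p r) -> plane_kernel rho p F Fr Ft Frr Frt ->
  (0 < r < rho)%R -> Fr r 0%R = RtoC r * p r.
Proof.
  intros Hp KF Hr'.
  apply (is_derive_C_unique (fun x => F x 0%R) r); [apply (pk_r KF); exact Hr' | ].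
  apply (is_derive_ext_loc (V := C_R_NormedModule) (fun x => RInt_C (fun x => RtoC x * p x) 0 x)).
  - apply filter_imp with (2 := locally_open_interval _ _ _ Hr'). intros x Hx.
    symmetry. apply (pk_axis KF). lra.
  - apply (is_derive_C_RInt (fun x => RtoC x * p x) 0 r).
    intros x. continuous_C ltac:(apply Hp).
Qed.

(** The functions P and Q of the first order system, with S = H + G and M = H - G. *)
Definition sumPart r t := RtoC r * (Hr r t + Gr r t) + RtoC r * a r * (H r t - G r t).
Definition diffPart r t := RtoC r * (Hr r t - Gr r t) + RtoC r * a r * (H r t + G r t)
  + 2 * ((1 - RtoC t) * (Ht r t - Gt r t) - (H r t - G r t)).

Ltac jc := intros [? ?]; continuous_C ltac:(first
    [ apply (pk_cont KG) | apply (pk_cont KH)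
    | apply (pk_cont_r KG) | apply (pk_cont_r KH)
    | apply (pk_cont_t KG) | apply (pk_cont_t KH)
    | apply continuous_RtoC; first [apply continuous_fst | apply continuous_snd]
    | apply (continuous_comp fst a); [apply continuous_fst | apply Ha] ]).

Lemma continuous_sumPart : jointly_continuous sumPart.
Proof. unfold sumPart. jc. Qed.

Lemma continuous_diffPart : jointly_continuous diffPart.
Proof. unfold diffPart. jc. Qed.

(** The equation Q_r = a P: the difference of the two kernel equations. *)
Lemma diffPart_derivative r t : (0 < r < rho)%R -> (0 < t < 1)%R ->
  is_derive_C (fun x => diffPart x t) r (a r * sumPart r t).
Proof.
  intros Hr0 Ht0. unfold diffPart. eapply is_derive_C_eq.
  - derive_C ltac:(first
    [ apply (pk_r KG); assumption | apply (pk_r KH); assumption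
    | apply (pk_rr KG); assumption | apply (pk_rr KH); assumption
    | apply (pk_tr KG); assumption | apply (pk_tr KH); assumption
    | apply Hda; assumption ]).
  - pose proof (pk_eq KG r t Hr0 Ht0) as E1.
    pose proof (pk_eq KH r t Hr0 Ht0) as E2. cbv beta in E2 |- *.
    unfold sumPart.
    match type of E1 with ?x = _ => match type of E2 with ?y = _ =>
      transitivity (a r * (RtoC r * (Hr r t + Gr r t) + RtoC r * a r * (H r t - G r t)) + (y - x)) end end.
    + field. apply RtoC_neq0; lra.
    + rewrite E1, E2. ring.
Qed.

Lemma is_derive_along_characteristic (F Fr : R -> R -> C) (Ft : C) c s :
  (0 < c < s)%R -> (s < rho)%R ->
  (forall r t, (0 < r < rho)%R -> is_derive_C (fun x => F x t) r (Fr r t)) ->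
  jointly_continuous Fr ->
  is_derive_C (F s) (1 - (c / s) ^ 2)%R Ft ->
  is_derive_C (fun x => F x (1 - (c / x) ^ 2)%R) s
     (Fr s (1 - (c / s) ^ 2)%R + 2 * (1 - RtoC (1 - (c / s) ^ 2)%R) / RtoC s * Ft).
Proof.
  intros Hc Hs HF HFr HFt.
  assert (Hs0 : (0 < s < rho)%R) by lra.
  eapply is_derive_C_eq.
  - apply (is_derive_C_comp2 F Fr Ft (fun x => x) (fun x => 1 - (c / x) ^ 2)%R s 1
      (2 * (1 - (1 - (c / s) ^ 2)) / s)%R).
    + apply filter_imp with (2 := locally_open_rect _ _ 0 1 _ _ Hs0 (characteristic_point c s Hc)).
      intros [u v] [Hu _]; simpl in *. apply HF, Hu.
    + exact HFt.
    + apply HFr.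
    + apply (is_derive_id (K := R_AbsRing)).
    + auto_derive; [lra | field; lra].
  - rewrite RtoC_div, RtoC_mult, (RtoC_minus 1 (1 - (c / s) ^ 2)) by lra. ring.
Qed.

(** The transport equation for P: the sum of the two kernel equations. *)
Lemma sumPart_derivative c s : (0 < c < s)%R -> (s < rho)%R ->
  is_derive_C (fun x => RtoC (/ x ^ 2) * sumPart x (1 - (c / x) ^ 2)%R) s
     (RtoC (/ s ^ 2) * (a s * diffPart s (1 - (c / s) ^ 2)%R)).
Proof.
  intros Hc Hs. assert (Hs0 : (0 < s < rho)%R) by lra.
  pose proof (characteristic_point c s Hc) as Ht0.
  unfold sumPart. eapply is_derive_C_eq.
  - apply is_derive_Cmult.
    + apply is_derive_RtoC. instantiate (1 := (- (2 * / s ^ 3))%R). auto_derive; [nra | field; lra].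
    + apply is_derive_Cplus; apply is_derive_Cmult.
      * apply is_derive_C_id.
      * apply is_derive_Cplus.
        -- apply is_derive_along_characteristic with (Fr := Hrr); try assumption;
           [apply (pk_rr KH) | apply (pk_cont_rr KH) | apply (pk_rt KH), Ht0].
        -- apply is_derive_along_characteristic with (Fr := Grr); try assumption;
           [apply (pk_rr KG) | apply (pk_cont_rr KG) | apply (pk_rt KG), Ht0].
      * apply is_derive_Cmult; [apply is_derive_C_id | apply Hda, Hs0].
      * apply is_derive_Cminus.
        -- apply is_derive_along_characteristic with (Fr := Hr); try assumption;
           [apply (pk_r KH) | apply (pk_cont_r KH) | apply (pk_t KH), Ht0].
        -- apply is_derive_along_characteristic with (Fr := Gr); try assumption;
           [apply (pk_r KG) | apply (pk_cont_r KG) | apply (pk_t KG), Ht0].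
  - pose proof (pk_eq KG s _ Hs0 Ht0) as E1.
    pose proof (pk_eq KH s _ Hs0 Ht0) as E2. cbv beta in E2 |- *.
    unfold diffPart.
    assert (k1 : RtoC (/ s ^ 2) = / (RtoC s * RtoC s)).
    { replace (s ^ 2)%R with (s * s)%R by ring. rewrite RtoC_inv, RtoC_mult by nra. reflexivity. }
    assert (k2 : RtoC (- (2 * / s ^ 3)) = - (2) / (RtoC s * RtoC s * RtoC s)).
    { replace (s ^ 3)%R with (s * s * s)%R by ring.
      assert (s * s * s <> 0)%R by (repeat apply Rmult_integral_contrapositive_currified; lra).
      rewrite RtoC_opp, RtoC_mult, RtoC_inv, !RtoC_mult by assumption. unfold Cdiv. ring. }
    rewrite k1, k2. clear k1 k2.
    set (t := (1 - (c / s) ^ 2)%R) in *. clearbody t.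
    match type of E1 with ?x = _ => match type of E2 with ?y = _ => match goal with |- _ = ?z =>
      transitivity (z + / (RtoC s * RtoC s) * (x + y)) end end end.
    + simpl. field. apply RtoC_neq0; lra.
    + rewrite E1, E2. ring.
Qed.

(** The first order relation between the two kernels. *)
Lemma kernel_relation r t : (0 < r < rho)%R -> (0 < t < 1)%R ->
  RtoC r * Hr r t + RtoC r * a r * H r t =
  (H r t - G r t) - (1 - RtoC t) * (Ht r t - Gt r t).
Proof.
  intros Hr0 Ht0.
  assert (PQ : sumPart r t = 0 /\ diffPart r t = 0).
  { assert (Jc : jointly_continuous (fun r t => (Hr r t + Gr r t) + a r * (H r t - G r t))) by jc.
    assert (Ja : jointly_continuous (fun r _ => a r)) by jc.
    destruct (bounded_on_rect _ 0 rho 0 1 Jc) as [m Hm].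
    destruct (bounded_on_rect _ 0 rho 0 1 Ja) as [A HA].
    apply (goursat_system_uniqueness sumPart diffPart a rho A m); try assumption.
    - apply Rle_trans with (2 := Hm r t ltac:(lra) ltac:(lra)), Cmod_ge_0.
    - exact continuous_sumPart.
    - exact continuous_diffPart.
    - intros x Hx. apply (HA x 0%R); lra.
    - exact diffPart_derivative.
    - exact sumPart_derivative.
    - intros x Hx. unfold sumPart. rewrite axis_difference by lra.
      rewrite (axis_derivative _ _ _ _ _ _ x Hq KG Hx).
      rewrite (axis_derivative (fun r => 2 * (a r * a r) - q r) H Hr Ht Hrr Hrt x) ; [ring | | exact KH | exact Hx].
      intros y. continuous_C ltac:(first [apply Hq | apply Ha]).
    - intros y Hy.
      assert (Z : forall (p : R -> C) (F Fr Ft Frr Frt : R -> R -> C),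
        plane_kernel rho p F Fr Ft Frr Frt -> Ft 0%R y = 0).
      { intros p F Fr Ft Frr Frt KF. apply (is_derive_C_unique (F 0%R) y).
        - apply (pk_t KF), Hy.
        - apply (is_derive_ext (V := C_R_NormedModule) (fun _ => RtoC 0)).
          + intros z. symmetry. apply (pk_zero KF).
          + apply is_derive_Cconst. }
      unfold diffPart. rewrite (Z _ _ _ _ _ _ KG), (Z _ _ _ _ _ _ KH).
      rewrite (pk_zero KG), (pk_zero KH). ring.
    - intros x y Hx Hy. unfold sumPart.
      replace (RtoC x * (Hr x y + Gr x y) + RtoC x * a x * (H x y - G x y)) with
        (RtoC x * ((Hr x y + Gr x y) + a x * (H x y - G x y))) by ring.
      rewrite Cmod_mult, Cmod_R, Rabs_pos_eq, Rmult_comm by lra.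
      apply Rmult_le_compat_r; [lra | apply Hm; lra]. }
  destruct PQ as [P0 Q0]. unfold sumPart, diffPart in P0, Q0.
  match type of P0 with ?x = _ => match type of Q0 with ?y = _ => match goal with |- _ = ?z =>
    transitivity (z + (x + y) / 2) end end end.
  - field.
  - rewrite P0, Q0. field.
Qed.

End DarbouxPair.

(** * The transmutation operators *)

(** With t = 1 - sigma^2 the weight is sigma^2, the factor that the chain rule produces
    when u (sigma^2 r) is differentiated in r. *)
Definition weighted (F : R -> R -> C) (r t : R) : C := RtoC (1 - t) * F r t.

(** The integrand of T F v (s) at sigma, extended to the plane in (s, sigma) by
    projecting sigma onto [0, 1]. *)
Definition integrand (F : R -> R -> C) (v : R -> C) (s sigma : R) : C :=
  RtoC (clamp 0 1 sigma) * (F s (1 - clamp 0 1 sigma ^ 2)%R * v (clamp 0 1 sigma ^ 2 * s)%R).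

Lemma jointly_continuous_integrand F v :
  jointly_continuous F -> (forall x, continuous v x) -> jointly_continuous (integrand F v).
Proof.
  intros HF Hv [r t]. unfold integrand. set (p := (r, t)).
  assert (Cc : continuous (fun p : R * R => clamp 0 1 (snd p)) p).
  { apply (continuous_comp snd (clamp 0 1)); [apply continuous_snd | apply continuous_clamp]. }
  assert (C2 : continuous (fun p : R * R => clamp 0 1 (snd p) ^ 2)%R p).
  { apply (continuous_comp (fun p : R * R => clamp 0 1 (snd p)) (fun x => x ^ 2)%R); [exact Cc | ].
    apply (ex_derive_continuous (V := R_NormedModule)). auto_derive. exact I. }
  repeat apply continuous_Cmult.
  - apply continuous_RtoC, Cc.
  - apply (continuous_comp_2 (fun p : R * R => fst p) (fun p : R * R => 1 - clamp 0 1 (snd p) ^ 2)%R F).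
    + apply continuous_fst.
    + apply (continuous_minus (V := R_NormedModule)); [apply continuous_const | exact C2].
    + apply HF.
  - apply (continuous_comp (fun p : R * R => clamp 0 1 (snd p) ^ 2 * fst p)%R v); [ | apply Hv].
    apply (continuous_mult (K := R_AbsRing)); [exact C2 | apply continuous_fst].
Qed.

Lemma jointly_continuous_weighted F : jointly_continuous F -> jointly_continuous (weighted F).
Proof.
  intros HF p. unfold weighted. apply continuous_Cmult; [ | apply HF].
  apply continuous_RtoC, (continuous_minus (V := R_NormedModule)); [apply continuous_const | ].
  destruct p; apply continuous_snd.
Qed.

(** The integrals in (f T_(1/f) v)' / f and in T_f [s v'] / s differ by a boundary term:
    the difference of their integrands is the derivative of
    x^2 / (2 s) * M(s, 1 - x^2) * v(x^2 s) with respect to x. *)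
Lemma integrand_identity rho (q a : R -> C) (G Gr Gt Grr Grt H Hr Ht Hrr Hrt : R -> R -> C)
  (v dv : R -> C) (s : R) :
  plane_kernel rho q G Gr Gt Grr Grt ->
  plane_kernel rho (fun r => 2 * (a r * a r) - q r) H Hr Ht Hrr Hrt ->
  (forall r, continuous q r) -> (forall r, continuous a r) ->
  (forall r, (0 < r < rho)%R -> is_derive_C a r (q r - a r * a r - a r / RtoC r)) ->
  (forall x, continuous v x) -> (forall x, continuous dv x) ->
  (forall x, (0 < x < s)%R -> is_derive_C v x (dv x)) ->
  (0 < s < rho)%R ->
  RInt_C (fun x => (a s * integrand H v s x + 1 * (integrand Hr v s x + integrand (weighted H) dv s x))
     + -(1) * integrand (weighted G) dv s x) 0 1 = - (a s * v s).
Proof.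
  intros KG KH Hq Ha Hda Hv Hdv Hd Hs.
  rewrite (RInt_C_FTC (fun x => RtoC (x ^ 2 / (2 * s)) * ((H s (1 - x ^ 2)%R - G s (1 - x ^ 2)%R) * v (x ^ 2 * s)%R)) _ 0 1).
  - replace (1 - 1 ^ 2)%R with 0%R by ring. replace (1 ^ 2 * s)%R with s by ring.
    replace (0 ^ 2 / (2 * s))%R with 0%R by (field; lra).
    rewrite (axis_difference rho q a G Gr Gt Grr Grt H Hr Ht Hrr Hrt) by (assumption || lra).
    replace (1 ^ 2 / (2 * s))%R with (/ (2 * s))%R by (field; lra).
    rewrite RtoC_inv, RtoC_mult by lra. eq_C. field. apply RtoC_neq0; lra.
  - lra.
  - intros x Hx.
    assert (Hx2 : (0 < x ^ 2 < 1)%R) by nra.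
    assert (D1 : is_derive (fun x => 1 - x ^ 2)%R x (- (2 * x))%R) by (auto_derive; [exact I | ring]).
    assert (Hxs : (0 < x ^ 2 * s < s)%R) by nra.
    assert (DF : forall F Ft : R -> R -> C, (forall t, (0 < t < 1)%R -> is_derive_C (F s) t (Ft s t)) ->
      is_derive_C (fun x => F s (1 - x ^ 2)%R) x (RtoC (- (2 * x)) * Ft s (1 - x ^ 2)%R)).
    { intros F Ft HF. rewrite <- scal_C.
      apply (is_derive_comp (V := C_R_NormedModule) (F s) (fun x => 1 - x ^ 2)%R); [ | exact D1].
      apply HF. lra. }
    assert (Dv : is_derive_C (fun x => v (x ^ 2 * s)%R) x (RtoC (2 * x * s) * dv (x ^ 2 * s)%R)).
    { rewrite <- scal_C.
      apply (is_derive_comp (V := C_R_NormedModule) v (fun x => x ^ 2 * s)%R).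
      - apply Hd, Hxs.
      - auto_derive; [exact I | ring]. }
    eapply is_derive_C_eq.
    + apply is_derive_Cmult.
      * apply is_derive_RtoC. instantiate (1 := (x / s)%R). auto_derive; [lra | field; lra].
      * apply is_derive_Cmult; [apply is_derive_Cminus | exact Dv].
        -- apply DF. intros t Ht0. apply (pk_t KH), Ht0.
        -- apply DF. intros t Ht0. apply (pk_t KG), Ht0.
    + pose proof (kernel_relation rho q a G Gr Gt Grr Grt H Hr Ht Hrr Hrt KG KH Hq Ha Hda s (1 - x ^ 2)%R Hs ltac:(lra)) as E.
      unfold integrand, weighted. rewrite (clamp_id 0 1 x) by lra.
      replace (RtoC (1 - (1 - x ^ 2))) with (RtoC x * RtoC x) by (rewrite <- RtoC_mult; f_equal; ring).
      replace (1 - RtoC (1 - x ^ 2)) with (RtoC x * RtoC x) in E.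
      2: { rewrite RtoC_minus. simpl. rewrite Rmult_1_r, RtoC_mult. ring. }
      rewrite !RtoC_opp, !RtoC_div, !RtoC_mult by lra.
      replace (RtoC (x ^ 2)) with (RtoC x * RtoC x) by (rewrite <- RtoC_mult; f_equal; ring).
      generalize dependent (H s (1 - x ^ 2)%R). generalize dependent (Hr s (1 - x ^ 2)%R). generalize dependent (Ht s (1 - x ^ 2)%R).
      generalize dependent (G s (1 - x ^ 2)%R). generalize dependent (Gt s (1 - x ^ 2)%R).
      generalize (v (x ^ 2 * s)%R) (dv (x ^ 2 * s)%R) (a s). clear - Hs. intros v0 dv0 a0 gt g ht hr h E.
      assert (S0 : RtoC s <> 0) by (apply RtoC_neq0; lra).
      match type of E with ?l = ?r => match goal with |- _ = ?z =>
        transitivity (z - (l - r) * (RtoC x * v0 / RtoC s)) end end.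
      * field. exact S0.
      * rewrite E. field. exact S0.
  - intros x _.
    assert (Cr : forall phi : R -> R, (forall x, ex_derive phi x) -> continuous phi x).
    { intros phi Hp. apply (ex_derive_continuous (V := R_NormedModule)), Hp. }
    apply continuous_Cmult; [apply continuous_RtoC, Cr; intros; auto_derive; lra | ].
    apply continuous_Cmult; [apply continuous_Cminus | ].
    + apply (continuous_curve H (fun _ => s)); [apply (pk_cont KH) | apply continuous_const | apply Cr; intros; auto_derive; exact I].
    + apply (continuous_curve G (fun _ => s)); [apply (pk_cont KG) | apply continuous_const | apply Cr; intros; auto_derive; exact I].
    + apply (continuous_comp (fun x => x ^ 2 * s)%R v); [apply Cr; intros; auto_derive; exact I | apply Hv].
  - assert (W : forall F w, jointly_continuous F -> (forall x, continuous w x) -> forall x, continuous (integrand F w s) x).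
    { intros F w HF Hw x. apply jointly_continuous_slice, jointly_continuous_integrand; assumption. }
    intros x. continuous_C ltac:(apply W; first [assumption | apply jointly_continuous_weighted; first [apply (pk_cont KH) | apply (pk_cont KG)] | apply (pk_cont KH) | apply (pk_cont KG) | apply (pk_cont_r KH)]).
Qed.

(** Differentiation of the integrand in s, for fixed sigma. *)
Lemma is_derive_integrand (F Fr : R -> R -> C) (v dv : R -> C) (rho r0 s x : R) :
  (forall r t, (0 < r < rho)%R -> is_derive_C (fun y => F y t) r (Fr r t)) ->
  (forall y, (0 < y < r0)%R -> is_derive_C v y (dv y)) ->
  (r0 <= rho)%R -> (0 < s < r0)%R ->
  is_derive_C (fun y => integrand F v y x) s (integrand Fr v s x + integrand (weighted F) dv s x).
Proof.
  intros HF Hv Hr0 Hs. unfold integrand, weighted.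
  pose proof (clamp_in 0 1 x ltac:(lra)) as Hc. set (c := clamp 0 1 x) in *. clearbody c.
  (* v need not be differentiable at 0, which is reached for c = 0 *)
  destruct (Req_dec c 0) as [-> | Hc0].
  - apply (is_derive_ext (V := C_R_NormedModule) (fun _ => RtoC 0)).
    + intros y. eq_C. ring.
    + eapply is_derive_C_eq; [apply is_derive_Cconst | ring].
  - assert (Hc2 : (0 < c ^ 2 <= 1)%R) by nra.
    assert (Hcs : (0 < c ^ 2 * s < r0)%R) by nra.
    eapply is_derive_C_eq.
    + apply is_derive_Cmult; [apply is_derive_Cconst | ].
      apply is_derive_Cmult; [apply HF; lra | ].
      apply (is_derive_comp (V := C_R_NormedModule) v (fun y => c ^ 2 * y)%R s _ (c ^ 2)%R (Hv _ Hcs)).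
      auto_derive; [exact I | ring].
    + rewrite scal_C. replace (1 - (1 - c ^ 2))%R with (c ^ 2)%R by ring. ring.
Qed.

(** The statement for functions extended to the line and to the plane. *)
Lemma transmutation_identity rho (q a f : R -> C) (G Gr Gt Grr Grt H Hr Ht Hrr Hrt : R -> R -> C)
  (v dv : R -> C) (r : R) :
  plane_kernel rho q G Gr Gt Grr Grt ->
  plane_kernel rho (fun r => 2 * (a r * a r) - q r) H Hr Ht Hrr Hrt ->
  (forall x, continuous q x) -> (forall x, continuous a x) -> (forall x, continuous f x) ->
  (forall x, (0 < x < rho)%R -> is_derive_C a x (q x - a x * a x - a x / RtoC x)) ->
  (forall x, (0 < x < rho)%R -> is_derive_C f x (f x * a x)) -> f 0%R = 1 ->
  (0 < r < rho)%R ->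
  (forall x, continuous v x) -> (forall x, continuous dv x) ->
  (forall x, (0 < x < r)%R -> is_derive_C v x (dv x)) ->
  f r * (v r + RInt_C (integrand H v r) 0 1) =
  RInt_C (fun s => f s * (dv s + RInt_C (integrand (weighted G) dv s) 0 1)) 0 r + v 0%R.
Proof.
  intros KG KH Hq Ha Hf Hda Hdf Hf0 Hr0 Hv Hdv Hd.
  assert (JH : jointly_continuous (integrand H v)).
  { apply jointly_continuous_integrand; [apply (pk_cont KH) | exact Hv]. }
  assert (JHr : jointly_continuous (integrand Hr v)).
  { apply jointly_continuous_integrand; [apply (pk_cont_r KH) | exact Hv]. }
  assert (JwH : jointly_continuous (integrand (weighted H) dv)).
  { apply jointly_continuous_integrand; [apply jointly_continuous_weighted, (pk_cont KH) | exact Hdv]. }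
  assert (JwG : jointly_continuous (integrand (weighted G) dv)).
  { apply jointly_continuous_integrand; [apply jointly_continuous_weighted, (pk_cont KG) | exact Hdv]. }
  assert (JK : jointly_continuous (fun s x => integrand Hr v s x + integrand (weighted H) dv s x)).
  { intros p. apply continuous_Cplus; [apply JHr | apply JwH]. }
  set (IH := fun s => RInt_C (integrand H v s) 0 1 : C).
  set (IG := fun s => RInt_C (integrand (weighted G) dv s) 0 1 : C).
  set (IK := fun s => RInt_C (fun x => integrand Hr v s x + integrand (weighted H) dv s x) 0 1 : C).
  assert (CH : forall x, continuous IH x).
  { intros x. apply (continuous_RInt_param (integrand H v) 0 1 x); [lra | exact JH]. }
  assert (CG : forall x, continuous IG x).
  { intros x. apply (continuous_RInt_param (integrand (weighted G) dv) 0 1 x); [lra | exact JwG]. }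
  assert (DH : forall s, (0 < s < r)%R -> is_derive_C IH s (IK s)).
  { intros s Hs. apply (is_derive_C_RInt_param (integrand H v)
      (fun s x => integrand Hr v s x + integrand (weighted H) dv s x) 0 1 0 r s Hs); [ | exact JH | exact JK].
    intros x y Hx. apply (is_derive_integrand H Hr v dv rho r); [apply (pk_r KH) | exact Hd | lra | exact Hx]. }
  assert (Id : forall s, (0 < s < r)%R -> a s * IH s + IK s - IG s = - (a s * v s)).
  { intros s Hs.
    rewrite <- (integrand_identity rho q a G Gr Gt Grr Grt H Hr Ht Hrr Hrt v dv s KG KH Hq Ha Hda Hv Hdv); [ | | lra].
    2: { intros x Hx. apply Hd. lra. }
    rewrite (RInt_C_linear (integrand H v s) (fun x => integrand Hr v s x + integrand (weighted H) dv s x)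
      (integrand (weighted G) dv s) (a s) 1 (-(1))).
    - change (a s * IH s + IK s - IG s = a s * IH s + 1 * IK s + - (1) * IG s). ring.
    - lra.
    - intros x. apply jointly_continuous_slice, JH.
    - intros x. apply (jointly_continuous_slice _ s x JK).
    - intros x. apply jointly_continuous_slice, JwG. }
  assert (IH0 : IH 0%R = 0).
  { unfold IH. rewrite (RInt_C_FTC (fun _ => RtoC 0) _ 0 1).
    - ring.
    - lra.
    - intros x _. eapply is_derive_C_eq; [apply is_derive_Cconst | ].
      unfold integrand. rewrite (pk_zero KH). ring.
    - intros x _. apply continuous_const.
    - intros x. apply jointly_continuous_slice, JH. }
  change (f r * (v r + IH r) = RInt_C (fun s => f s * (dv s + IG s)) 0 r + v 0%R).
  clearbody IH IG IK.
  rewrite (RInt_C_FTC (fun s => f s * (v s + IH s)) _ 0 r).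
  - eq_C. rewrite Hf0, IH0. ring.
  - lra.
  - intros s Hs. eapply is_derive_C_eq.
    + apply is_derive_Cmult; [apply Hdf; lra | ].
      apply is_derive_Cplus; [apply Hd, Hs | apply DH, Hs].
    + specialize (Id s Hs).
      match type of Id with ?l = ?m => match goal with |- _ = ?z =>
        transitivity (z + f s * (l - m)) end end; [ring | rewrite Id; ring].
  - intros s _. continuous_C ltac:(auto).
  - intros s. continuous_C ltac:(auto).
Qed.

Theorem theorem31
  (Omega : C -> Prop) (rho : R)
  (hOmega : star_domain Omega rho) (hrho : (0 < rho)%R)
  (q f df ddf : R -> C)
  (hq : exists dq : R -> C, is_C1_on (Icc 0 rho) q dq)
  (hf : is_C1_on (Icc 0 rho) f df)
  (hdf : is_C1_on (Icc 0 rho) df ddf)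
  (hf_neq0 : forall r : R, Icc 0 rho r -> f r <> 0)
  (hf_eq : forall r : R, (0 < r < rho)%R ->
     ddf r + / RtoC r * df r - q r * f r = 0)
  (hf_C2 : C2_closure Omega (fun z : C => f (Cmod z)))
  (hf0 : f 0%R = 1)
  (hf_lim : filterlim (fun r : R => RtoC r * df r) (at_right 0)
              (locally (RtoC 0)))
  (Gf Ginvf : R -> R -> C)
  (hGf : is_kernel rho q Gf)
  (hGinvf : is_kernel rho (q_inv q f df) Ginvf)
  (u du : R -> C)
  (hu : is_C1_on (Ico 0 rho) u du)
  (r : R) (hr : Ico 0 rho r) :
  T Ginvf u r =
    / f r * (@RInt C_R_CompleteNormedModule
               (fun s : R => f s * T Gf (fun x : R => RtoC x * du x) s / RtoC s)
               0 r
             + u 0%R).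
Proof.
  set (c := clamp 0 rho).
  assert (Hc : forall x, Icc 0 rho (c x)) by (intros x; apply clamp_in; lra).
  assert (cid : forall x, (0 <= x <= rho)%R -> c x = x) by (intros x Hx; apply clamp_id, Hx).
  destruct hq as [dq [hq _]].
  assert (Cq : forall x, continuous (fun x => q (c x)) x).
  { intros x. apply continuous_on_clamp; [lra | apply (continuous_on_of_derive _ _ dq hq)]. }
  assert (Cf : forall x, continuous (fun x => f (c x)) x).
  { intros x. apply continuous_on_clamp; [lra | apply (continuous_on_of_derive _ _ df (proj1 hf))]. }
  assert (Cdf : forall x, continuous (fun x => df (c x)) x).
  { intros x. apply continuous_on_clamp; [lra | apply (proj2 hf)]. }
  set (a := fun x => df (c x) * / f (c x)).
  assert (Ca : forall x, continuous a x).
  { intros x. apply continuous_Cmult; [apply Cdf | ].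
    apply (continuous_Cinv (fun y => f (c y))); [apply Cf | apply hf_neq0, Hc]. }
  assert (Df : forall x, (0 < x < rho)%R -> is_derive_C (fun x => f (c x)) x (df x)).
  { intros x Hx. apply is_derive_C_clamp; [exact Hx | ]. apply (proj1 hf). unfold Icc; lra. }
  assert (Ddf : forall x, (0 < x < rho)%R -> is_derive_C (fun x => df (c x)) x (ddf x)).
  { intros x Hx. apply is_derive_C_clamp; [exact Hx | ]. apply (proj1 hdf). unfold Icc; lra. }
  assert (Da : forall x, (0 < x < rho)%R -> is_derive_C a x (q (c x) - a x * a x - a x / RtoC x)).
  { intros x Hx. pose proof (hf_neq0 x ltac:(unfold Icc; lra)) as Hf0.
    pose proof (hf_eq x Hx) as E. eapply is_derive_C_eq.
    - apply is_derive_Cmult; [apply Ddf, Hx | apply (is_derive_Cinv (fun y => f (c y))); [apply Df, Hx | ]].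
      apply hf_neq0, Hc.
    - unfold a. rewrite cid by lra.
      assert (X : RtoC x <> 0) by (apply RtoC_neq0; lra).
      match type of E with ?l = _ => match goal with |- _ = ?z =>
        transitivity (z + l / f x) end end; [field; split; assumption | rewrite E; field; split; assumption]. }
  destruct (plane_kernel_of_is_kernel rho q (fun x => q (c x)) Gf hrho ltac:(intros x Hx; cbv beta; rewrite cid by exact Hx; reflexivity) hGf)
    as (Gr & Gt & Grr & Grt & KG).
  destruct (plane_kernel_of_is_kernel rho (q_inv q f df) (fun x => 2 * (a x * a x) - q (c x)) Ginvf hrho)
    as (Hr & Ht & Hrr & Hrt & KH).
  { intros x Hx. unfold a, q_inv. rewrite cid by exact Hx. simpl. field. apply hf_neq0, Hx. }
  { exact hGinvf. }
  set (G := plane_extension rho Gf) in *. set (H := plane_extension rho Ginvf) in *.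
  assert (EG : forall s x, (0 <= s <= rho)%R -> (0 <= x <= 1)%R -> Gf s (1 - x ^ 2)%R = G s (1 - x ^ 2)%R).
  { intros s x Hs Hx. unfold G, plane_extension. rewrite !clamp_id by nra. reflexivity. }
  assert (EH : forall s x, (0 <= s <= rho)%R -> (0 <= x <= 1)%R -> Ginvf s (1 - x ^ 2)%R = H s (1 - x ^ 2)%R).
  { intros s x Hs Hx. unfold H, plane_extension. rewrite !clamp_id by nra. reflexivity. }
  destruct hr as [hr0 hr1].
  assert (Hfr : f r <> 0) by (apply hf_neq0; unfold Icc; lra).
  destruct (Rle_lt_or_eq_dec 0 r hr0) as [hpos | <-].
  - (* u and du are only known on [0, rho): they are extended from [0, r]. *)
    set (v := fun x => u (clamp 0 r x)). set (dv := fun x => du (clamp 0 r x)).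
    assert (Sub : forall x, Icc 0 r x -> Ico 0 rho x) by (unfold Icc, Ico; intros; lra).
    assert (Cv : forall x, continuous v x).
    { intros x. apply continuous_on_clamp; [lra | ]. apply (continuous_on_subset (Ico 0 rho) (Icc 0 r) u Sub).
      apply (continuous_on_of_derive _ _ du (proj1 hu)). }
    assert (Cdv : forall x, continuous dv x).
    { intros x. apply continuous_on_clamp; [lra | ].
      apply (continuous_on_subset (Ico 0 rho) (Icc 0 r) du Sub (proj2 hu)). }
    assert (vid : forall x, (0 <= x <= r)%R -> v x = u x) by (intros x Hx; unfold v; rewrite clamp_id; [reflexivity | exact Hx]).
    assert (dvid : forall x, (0 <= x <= r)%R -> dv x = du x) by (intros x Hx; unfold dv; rewrite clamp_id; [reflexivity | exact Hx]).
    assert (Dv : forall x, (0 < x < r)%R -> is_derive_C v x (dv x)).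
    { intros x Hx. rewrite dvid by lra.
      apply (is_derive_ext_loc (V := C_R_NormedModule) u).
      - apply filter_imp with (2 := locally_open_interval _ _ _ Hx). intros y Hy. symmetry. apply vid. lra.
      - apply (is_derive_on_interior (Ico 0 rho)); [ | apply (proj1 hu); unfold Ico; lra].
        apply filter_imp with (2 := locally_open_interval _ _ _ Hx). intros y Hy. unfold Ico; lra. }
    assert (TH : T Ginvf u r = v r + RInt_C (integrand H v r) 0 1).
    { unfold T. rewrite vid by lra. f_equal. apply (RInt_ext (V := C_R_CompleteNormedModule)).
      intros x Hx. rewrite Rmin_left, Rmax_right in Hx by lra. unfold integrand.
      rewrite (clamp_id 0 1 x) by lra.
      assert (0 <= x ^ 2 <= 1)%R by nra. assert (0 <= x ^ 2 * r <= r)%R by (split; nra). rewrite vid by lra. rewrite EH by lra. eq_C. ring. }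
    assert (TG : forall s, (0 < s < r)%R -> T Gf (fun x => RtoC x * du x) s =
       RtoC s * (dv s + RInt_C (integrand (weighted G) dv s) 0 1)).
    { intros s Hs. unfold T. rewrite dvid by lra.
      assert (Jw : jointly_continuous (integrand (weighted G) dv)).
      { apply jointly_continuous_integrand; [apply jointly_continuous_weighted, (pk_cont KG) | exact Cdv]. }
      assert (Cw : forall x, continuous (integrand (weighted G) dv s) x) by (intros x; apply jointly_continuous_slice, Jw).
      rewrite (RInt_ext (V := C_R_CompleteNormedModule) _ (fun x => RtoC s * integrand (weighted G) dv s x
         + 0 * integrand (weighted G) dv s x + 0 * integrand (weighted G) dv s x)).
      - rewrite RInt_C_linear by (assumption || lra).
        set (w := RInt_C (integrand (weighted G) dv s) 0 1 : C). clearbody w. ring.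
      - intros x Hx. rewrite Rmin_left, Rmax_right in Hx by lra. unfold integrand, weighted.
        rewrite (clamp_id 0 1 x) by lra.
      assert (0 <= x ^ 2 <= 1)%R by nra. assert (0 <= x ^ 2 * s <= r)%R by (split; nra). rewrite dvid by lra. rewrite EG by lra.
        replace (1 - (1 - x ^ 2))%R with (x ^ 2)%R by ring. rewrite RtoC_mult. eq_C. ring. }
    rewrite TH.
    rewrite (RInt_ext (V := C_R_CompleteNormedModule)
      (fun s => f s * T Gf (fun x => RtoC x * du x) s / RtoC s)
      (fun s => f (c s) * (dv s + RInt_C (integrand (weighted G) dv s) 0 1))).
    + assert (TI : f (c r) * (v r + RInt_C (integrand H v r) 0 1) =
        RInt_C (fun s => f (c s) * (dv s + RInt_C (integrand (weighted G) dv s) 0 1)) 0 r + v 0%R).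
      { apply (transmutation_identity rho (fun x => q (c x)) a (fun x => f (c x)) G Gr Gt Grr Grt H Hr Ht Hrr Hrt);
          try assumption.
        - intros x Hx. eapply is_derive_C_eq; [apply Df, Hx | ]. unfold a. rewrite cid by lra. field.
          apply hf_neq0. unfold Icc; lra.
        - rewrite cid by lra. exact hf0.
        - lra. }
      rewrite cid, (vid 0%R) in TI by lra.
      match type of TI with _ = ?z => change (v r + RInt_C (integrand H v r) 0 1 = / f r * z) end.
      rewrite <- TI. generalize (v r + RInt_C (integrand H v r) 0 1). intros w. field. exact Hfr.
    + intros s Hs. rewrite Rmin_left, Rmax_right in Hs by lra. rewrite TG by exact Hs. rewrite cid by lra.
      set (w := RInt_C (integrand (weighted G) dv s) 0 1 : C). clearbody w. eq_C. field. apply RtoC_neq0; lra.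
  - rewrite (RInt_point (V := C_R_CompleteNormedModule)). unfold T.
    rewrite (RInt_ext (V := C_R_CompleteNormedModule) _ (fun _ => RtoC 0)).
    + rewrite (RInt_C_FTC (fun _ => RtoC 0)).
      * rewrite hf0. change (u 0%R + (0 - 0) = / 1 * (0 + u 0%R)). field.
      * lra.
      * intros x _. apply is_derive_Cconst.
      * intros x _. apply continuous_const.
      * intros x. apply continuous_const.
    + intros x Hx. rewrite Rmin_left, Rmax_right in Hx by lra. rewrite EH by lra.
      rewrite (pk_zero KH). eq_C. ring.
Qed.
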